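(* Let $C\in\Sigma_{n-1}$ be a sash of length $n-1\ge0$. Then $$\Delta_S(C)=\emptyset\otimes C+C\otimes\emptyset+\sum_{d}I_d\otimes J_d,$$ where $d$ runs over all allowable dottings of $C$, $I_d=\sum[\underline A,\overline A]$ is the sum of all sashes in the interval $[\underline A,\overline A]$ and $J_d=\sum[\underline B,\overline B]$ is the sum of all sashes in the interval $[\underline B,\overline B]$ (intervals in the lattices of sashes of the relevant lengths), with $\underline A,\overline A,\underline B,\overline B$ computed from $d$ as in the context.
   Context: **Sashes and order.** A sash of length $m\ge 0$ is a tiling of a $1\times m$ rectangle by black $1\times1$ squares ($\mathsf b$), white $1\times1$ squares ($\mathsf w$) and white $1\times2$ rectangles ($\mathsf r$); positions are numbered $1,\dots,m$ from left to right, and a rectangle occupies two positions, its left half and its right half. There is one sash of length $0$, denoted $\varepsilon$, and a formal sash of length $-1$, denoted $\emptyset$. $\Sigma_m$ is the set of sashes of length $m$. $S_n$ is the set of permutations of $[n]=\{1,\dots,n\}$ with the weak order ($x\le x'$ iff the set of inversions, i.e. pairs of values $(x_i,x_j)$ with $i<j$ and $x_i>x_j$, of $x$ is contained in that of $x'$). $x\in S_n$ is a Pell permutation if $x_i-x_{i+1}\le 2$ for all $i$ and whenever $x_i=x_{i+1}+2$ the value $x_{i+1}+1$ appears to the right of $x_{i+1}$; $P_n$ is the set of these, with the order induced by the weak order. The map $\sigma:S_n\to\Sigma_{n-1}$: position $i$ of $\sigma(x)$ is a black square if $i+1$ is to the right of $i$ in $x$, a white square if $i+1$ is to the left of $i$,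 except that if $i+1$ is to the right of $i$ and $i+2$ is to the left of $i$ then a rectangle occupies positions $i,i+1$; $\sigma(\emptyset)=\emptyset$, $\sigma(1)=\varepsilon$. Restricted to $P_n$, $\sigma$ is a bijection onto $\Sigma_{n-1}$ with inverse $\eta$; $\Sigma_{n-1}$ is ordered so that $\sigma:P_n\to\Sigma_{n-1}$ is an order isomorphism. **Coproduct.** $\pi_\downarrow:S_n\to P_n$ is defined recursively: $\pi_\downarrow(x)=x$ if $x\in P_n$; otherwise choose any $i$ with $x_i>x_{i+1}$ such that either some value strictly between $x_{i+1}$ and $x_i$ appears to the left of $x_i$, or at least two such values appear to the right of $x_{i+1}$; swap $x_i,x_{i+1}$ to get $x'$ and put $\pi_\downarrow(x)=\pi_\downarrow(x')$ (known to be well defined). Over a field $\mathbb K$, with linear extensions: $\Delta(x)=\sum_{i=0}^n\mathrm{st}(x_1\cdots x_i)\otimes\mathrm{st}(x_{i+1}\cdots x_n)$ for $x\in S_n$ ($\mathrm{st}$ = standardization, empty words give $\emptyset$); $c(z)=\sum_{y:\pi_\downarrow(y)=z}y$ for $z\in P_n$; $\rho(x)=x$ if $x$ is Pell and $0$ for other permutations. Then $\Delta_S(C)=(\sigma\otimes\sigma)(\rho\otimes\rho)\,\Delta(c(\eta(C)))$. **Allowable dottings.** A dotting of $C\in\Sigma_{n-1}$ is $C$ together with a dot in each position of some subset of its $n-1$ positions. It is allowable if: (1) it has at least one dot; (2) the first dot may be in any position, and the dotted positions alternate, from left to right, between a black square (or the left half of a rectangle) and a white square (or the right half of a rectangle);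 (3) no rectangle has its left half dotted and its right half undotted, and no undotted black square is immediately followed by a dotted white square. **$A$ and $B$.** Write an allowable dotting as $d=c_1\bullet_1c_2\bullet_2\cdots c_j\bullet_jc_{j+1}$, where $\bullet_i$ is the $i$-th dotted position and the $c_i$ are the undotted sub-sashes in between ($c_{i+1}=\varepsilon$ if $\bullet_i,\bullet_{i+1}$ are adjacent positions). If $\bullet_i$ is on the right half of a rectangle whose left half is undotted, that left half, in the last position of $c_i$, is replaced by a black square. Let $\mathsf q$ be an extra symbol, a ''mystery square'' (occupying one position). If $\bullet_1$ is on a black square or left half of a rectangle, $A$ is the concatenation of the $c_i$ with $i$ odd with one $\mathsf q$ between consecutive ones ($A=c_1\,\mathsf q\,c_3\,\mathsf q\cdots$), and $B$ is the same with $i$ even ($B=c_2\,\mathsf q\,c_4\,\mathsf q\cdots$). If $\bullet_1$ is on a white square or right half of a rectangle, $A$ uses the even $i$ and $B$ the odd $i$. **The four sashes.** - $\underline A$: a mystery square of $A$ following $c_i$ is replaced by a white square if $\bullet_i$ and $\bullet_{i+1}$ are on the two halves of the same rectangle, and by a black square otherwise. - $\overline A$: process the mystery squares of $A$ from left to right. For the one following $c_i$: (a) if $\bullet_i,\bullet_{i+1}$ are on a black square and the white square immediately after it, then: if $c_{i+2}$ starts with a white square, replace the mystery square and that white square by a rectangle; otherwise replace the mystery square by a black square. (b) If not, then: if $c_i$ ends in a black square, or $c_i=\varepsilon$ and the previous mystery square has been changed to a black square, replace the mystery square and the black square before it by a rectangle; otherwise replace the mystery square by a white square. - $\underline B$: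 replace all mystery squares of $B$ by black squares. - $\overline B$: replace all mystery squares of $B$ by white squares, except that a mystery square preceded by a black square is replaced, together with that black square, by a rectangle. *)

(* Defs.v *)
From HB Require Import structures.
From mathcomp Require Import all_boot all_order all_algebra.
From mathcomp Require Import boolp.
From mathcomp Require Import freeg.

Set Implicit Arguments.
Unset Strict Implicit.
Unset Printing Implicit Defensive.

Import GRing.Theory.
Local Open Scope ring_scope.

(* black square, white square, white rectangle *)
Variant tile := tb | tw | tr.

Definition tile_code (t : tile) : option bool :=
  match t with tb => Some true | tw => Some false | tr => None end.
Definition tile_decode (o : option bool) : tile :=
  match o with Some true => tb | Some false => tw | None => tr end.
Lemma tile_codeK : cancel tile_code tile_decode. Proof. by case. Qed.
HB.instance Definition _ := Countable.copy tile (can_type tile_codeK).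

Definition sash := seq tile.

(* [None] is the formal sash of length -1; [Some [::]] is the empty sash. *)
Definition esash := option sash.

Definition slen (C : sash) : nat :=
  sumn [seq if t == tr then 2 else 1 | t <- C].

(* The list of all sashes of length m: see [mem_Sigma]
   and [Sigma_uniq]. *)
Fixpoint Sigma (m : nat) : seq sash :=
  match m with
  | 0 => [:: [::]]
  | 1 => [:: [:: tb]; [:: tw]]
  | (m'.+1 as k).+1 => [seq tb :: C | C <- Sigma k] ++
                       [seq tw :: C | C <- Sigma k] ++
                       [seq tr :: C | C <- Sigma m']
  end.

Lemma slen_cons t C : slen (t :: C) = ((if t == tr then 2 else 1) + slen C)%N.
Proof. by []. Qed.

Lemma mem_Sigma m C : (C \in Sigma m) = (slen C == m).
Proof.
have mem_cons_map (t u : tile) (D : sash) (s : seq sash) :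
    (t :: D \in [seq u :: E | E <- s]) = (t == u) && (D \in s).
  apply/mapP/andP => [[E Es [-> ->]]|[/eqP-> Ds]]; first by rewrite eqxx.
  by exists D.
have nil_map (u : tile) (s : seq sash) : ([::] \in [seq u :: E | E <- s]) = false.
  by apply/negP => /mapP[].
have [k] := ubnP m; elim: k m C => // k IHk [|[|m]] C le_mk.
- rewrite inE; case: C => [|t C]; first by [].
  by rewrite slen_cons; case: t.
- case: C => [|t [|u C]]; first by [].
    by rewrite slen_cons; case: t.
  by rewrite !slen_cons !inE; case: t; case: u.
case: C => [|t C]; first by rewrite /= !mem_cat !nil_map.
have IH1 := IHk m.+1 C le_mk; have IH2 := IHk m C (ltnW le_mk).
rewrite [Sigma _]/= -/(Sigma m.+1) !mem_cat !mem_cons_map slen_cons IH1 IH2.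
by case: t; rewrite /= ?orbF.
Qed.

Lemma Sigma_uniq m : uniq (Sigma m).
Proof.
have inj_cons (t : tile) : injective (cons t) by move=> C D [].
have [k] := ubnP m; elim: k m => // k IHk [|[|m]] // le_mk.
rewrite [Sigma _]/= -/(Sigma m.+1) !cat_uniq !(map_inj_uniq (inj_cons _)).
rewrite (IHk m.+1 le_mk) (IHk m (ltnW le_mk)) !andbT /=.
apply/andP; split; apply/hasPn => C.
  by rewrite mem_cat => /orP[] /mapP[D _ ->]; apply/negP => /mapP[E _ []].
by move=> /mapP[D _ ->]; apply/negP => /mapP[E _ []].
Qed.

Definition is_perm (x : seq nat) : bool := perm_eq x (iota 1 (size x)).

Definition left_of (x : seq nat) (a b : nat) : bool :=
  (index a x < index b x)%N.

Definition inversions (x : seq nat) : seq (nat * nat) :=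
  [seq p <- [seq (a, b) | a <- x, b <- x] | (p.2 < p.1)%N && left_of x p.1 p.2].

Definition weak_le (x y : seq nat) : bool :=
  all (mem (inversions y)) (inversions x).

(* In [pell], [reducible] and [swap_at], [i] is a 0-based index. *)
Definition pell (x : seq nat) : bool :=
  is_perm x &&
  all (fun i => let a := nth 0%N x i in let b := nth 0%N x i.+1 in
         (a <= b + 2)%N && ((a == b + 2)%N ==> left_of x b b.+1))
      (iota 0 (size x).-1).

(* [sigma_rec x i k] fills the [k] positions [i, ..., i + k - 1]. *)
Fixpoint sigma_rec (x : seq nat) (i k : nat) {struct k} : sash :=
  match k with
  | 0 => [::]
  | k'.+1 =>
    if left_of x i.+1 i then tw :: sigma_rec x i.+1 k'
    else match k' with
         | 0 => [:: tb]
         | k''.+1 => if left_of x i.+2 i then tr :: sigma_rec x i.+2 k''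
                     else tb :: sigma_rec x i.+1 k'
         end
  end.

Definition sigma (x : seq nat) : esash :=
  if x is [::] then None else Some (sigma_rec x 1 (size x).-1).

(* The inverse of [sigma] on Pell permutations. *)
Definition eta (C : sash) : seq nat :=
  head [::] [seq x <- permutations (iota 1 (slen C).+1)
            | pell x && (sigma x == Some C)].

(* The order transported along [sigma]; meaningful between sashes of equal
   length. *)
Definition sash_le (C D : sash) : bool := weak_le (eta C) (eta D).

Definition reducible (x : seq nat) (i : nat) : bool :=
  let a := nth 0%N x i in let b := nth 0%N x i.+1 in
  let between v := (b < v < a)%N in
  [&& (i.+1 < size x)%N, (b < a)%N &
      has between (take i x) || (2 <= count between (drop i.+2 x))%N].

Definition swap_at (x : seq nat) (i : nat) : seq nat :=
  take i x ++ [:: nth 0%N x i.+1; nth 0%N x i] ++ drop i.+2 x.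

(* [pi_down x z]: z is a value of the downward projection of x, for some
   sequence of choices of i. *)
Inductive pi_down : seq nat -> seq nat -> Prop :=
| pi_down_stop x : pell x -> pi_down x x
| pi_down_step x i z : ~~ pell x -> reducible x i ->
    pi_down (swap_at x i) z -> pi_down x z.

(* Standardization of a word with distinct letters. *)
Definition st (w : seq nat) : seq nat :=
  [seq count (fun u => u <= v)%N w | v <- w].

Section Coproduct.
Variable K : fieldType.

(* The free module on T * U is the tensor product of those on T and U. *)
Definition tens (T U : choiceType) (u : {freeg T / K}) (v : {freeg U / K}) :
    {freeg (T * U) / K} :=
  fglift (fun a => fglift (fun b => << (a, b) >> : {freeg (T * U) / K}) v) u.

(* The tensor product of the linear extensions of f and g. *)
Definition tens_map (T U T' U' : choiceType)
    (f : T -> {freeg T' / K}) (g : U -> {freeg U' / K})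
    (w : {freeg (T * U) / K}) : {freeg (T' * U') / K} :=
  fglift (fun p : T * U => tens (f p.1) (g p.2)) w.

Definition Delta (w : {freeg (seq nat) / K}) :
    {freeg (seq nat * seq nat) / K} :=
  fglift (fun x : seq nat => \sum_(i < (size x).+1)
           tens << st (take i x) >> << st (drop i x) >>) w.

Definition csum (z : seq nat) : {freeg (seq nat) / K} :=
  \sum_(y <- permutations (iota 1 (size z)) | `[< pi_down y z >]) << y >>.

Definition rho (x : seq nat) : {freeg (seq nat) / K} :=
  if pell x then << x >> else 0.

Definition sigma_lin (x : seq nat) : {freeg esash / K} := << sigma x >>.

Definition DeltaS (C : sash) : {freeg (esash * esash) / K} :=
  tens_map sigma_lin sigma_lin (tens_map rho rho (Delta (csum (eta C)))).

Definition interval_sum (D E : sash) : {freeg esash / K} :=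
  \sum_(F <- Sigma (slen D) | sash_le D F && sash_le F E) << Some F >>.

End Coproduct.

(* The content of one position of a sash: black square, white square, left or
   right half of a rectangle. *)
Variant cell := CB | CW | CL | CR.

Definition cell_code (c : cell) : bool * bool :=
  match c with CB => (true, true) | CW => (true, false)
             | CL => (false, true) | CR => (false, false) end.
Definition cell_decode (p : bool * bool) : cell :=
  match p with (true, true) => CB | (true, false) => CW
             | (false, true) => CL | (false, false) => CR end.
Lemma cell_codeK : cancel cell_code cell_decode. Proof. by case. Qed.
HB.instance Definition _ := Countable.copy cell (can_type cell_codeK).

Definition cells (C : sash) : seq cell :=
  flatten [seq match t with tb => [:: CB] | tw => [:: CW]
                          | tr => [:: CL; CR] end | t <- C].

(* A left half that has lost its right half becomes a black square.  A right
   half without its left half never occurs in an allowable dotting. *)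
Fixpoint tiles_of (s : seq cell) : sash :=
  match s with
  | [::] => [::]
  | CL :: s' => if s' is CR :: s'' then tr :: tiles_of s''
                else tb :: tiles_of s'
  | CB :: s' => tb :: tiles_of s'
  | _ :: s' => tw :: tiles_of s'
  end.

(* A dotting is the bit sequence d of its dotted positions; positions are
   numbered from 1. *)
Section Dotting.
Variables (C : sash) (d : bitseq).

Definition cell_at (p : nat) : cell := nth CW (cells C) p.-1.
Definition dots : seq nat := [seq p <- iota 1 (size d) | nth false d p.-1].
Definition dotted (p : nat) : bool := p \in dots.

Definition black_or_left (p : nat) : bool := cell_at p \in [:: CB; CL].

Definition allowable : bool :=
  [&& dots != [::],
      sorted (fun e f => e != f) [seq black_or_left p | p <- dots] &
      all (fun p =>
             ~~ [&& cell_at p == CL, dotted p & ~~ dotted p.+1] &&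
             ~~ [&& cell_at p == CB, ~~ dotted p, cell_at p.+1 == CW
                  & dotted p.+1])
          (iota 1 (size d))].

(* The position of the i-th dot for 1 <= i <= j, with the conventions 0 for
   i = 0 and (size d).+1 for i = j + 1. *)
Definition dot_pos (i : nat) : nat := nth (size d).+1 (0%N :: dots) i.

(* The undotted sub-sash c_i between dots i - 1 and i, for 1 <= i <= j + 1,
   where j is the number of dots. *)
Definition piece (i : nat) : sash :=
  tiles_of (take (dot_pos i - dot_pos i.-1).-1 (drop (dot_pos i.-1) (cells C))).

(* [Mystery i] is the mystery square that follows c_i. *)
Variant mtile := Tile of tile | Mystery of nat.

Fixpoint join_pieces (s : seq nat) : seq mtile :=
  match s with
  | [::] => [::]
  | [:: i] => map Tile (piece i)
  | i :: s' => map Tile (piece i) ++ Mystery i :: join_pieces s'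
  end.

Definition pieces_of_parity (e : bool) : seq mtile :=
  join_pieces [seq i <- iota 1 (size dots).+1 | odd i == e].

Definition mA : seq mtile := pieces_of_parity (black_or_left (dot_pos 1)).
Definition mB : seq mtile := pieces_of_parity (~~ black_or_left (dot_pos 1)).

Definition same_rectangle (i : nat) : bool :=
  (cell_at (dot_pos i) == CL) && (dot_pos i.+1 == (dot_pos i).+1).

Definition black_then_white (i : nat) : bool :=
  [&& cell_at (dot_pos i) == CB, dot_pos i.+1 == (dot_pos i).+1
    & cell_at (dot_pos i.+1) == CW].

Definition lowA : sash :=
  [seq match q with
       | Tile t => t
       | Mystery i => if same_rectangle i then tw else tb
       end | q <- mA].

(* [acc] is the part of the sash already produced.  When [Mystery i] is
   reached, [acc] ends in a black square iff c_i does, or c_i is empty and the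
   previous mystery square has become a black square; and the remaining word
   starts with [Tile tw] iff c_(i+2) starts with a white square. *)
Fixpoint highA_rec (acc : sash) (s : seq mtile) : sash :=
  match s with
  | [::] => acc
  | Tile t :: s' => highA_rec (rcons acc t) s'
  | Mystery i :: s' =>
    if black_then_white i then
      match s' with
      | Tile tw :: s'' => highA_rec (rcons acc tr) s''
      | _ => highA_rec (rcons acc tb) s'
      end
    else if last tw acc == tb then
      highA_rec (rcons (take (size acc).-1 acc) tr) s'
    else highA_rec (rcons acc tw) s'
  end.

Definition highA : sash := highA_rec [::] mA.

Definition lowB : sash :=
  [seq if q is Tile t then t else tb | q <- mB].

Fixpoint highB_rec (s : seq mtile) : sash :=
  match s with
  | [::] => [::]
  | Tile tb :: Mystery _ :: s' => tr :: highB_rec s'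
  | Tile t :: s' => t :: highB_rec s'
  | Mystery _ :: s' => tw :: highB_rec s'
  end.

Definition highB : sash := highB_rec mB.

End Dotting.

(* Main.v *)
Require Import Defs.
From HB Require Import structures.
From mathcomp Require Import all_boot all_order all_algebra.
From mathcomp Require Import boolp.
From mathcomp Require Import freeg.
From mathcomp Require Import zify.

Set Implicit Arguments.
Unset Strict Implicit.
Unset Printing Implicit Defensive.

Import GRing.Theory.

(** The map from permutations to sashes only depends on the relative order of the values
    i, i + 1, i + 2 for each i. Encode a sash by its levels: 0 for a black square, 1 for a
    left half of a rectangle, 2 for a white square or a right half. The sashes are then
    the words over 0, 1, 2 in which every 1 is followed by a 2. The level of x at i is 2 if
    i + 1 precedes i, else 1 if i + 2 precedes i, else 0 ([lev_sash_of]).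

    Two facts make this encoding useful. First, the swaps that define the projection to
    Pell permutations preserve levels ([plevel_swap_at]); as a Pell permutation is
    determined by its levels ([pell_inj]), the fibre of the projection over the Pell
    permutation of C consists of all permutations with sash C ([pi_downE]). Secondly, the
    inversions of a Pell permutation are generated by the pairs (i + 1, i) and (i + 2, i)
    that the levels record ([pell_inversion]), so the order on sashes is the componentwise
    order of levels ([sash_leE]).

    Hence the coproduct of C counts the cuts of permutations with sash C whose two
    standardized parts are Pell. Such a cut is given by the set T of letters of the first
    part and by the sashes F and G of the two parts. The level at i of the whole
    permutation is a function of F, G and the membership of i, i + 1, i + 2 in T
    ([plevel_merge]), and setting it equal to the level of C splits into separate conditions
    on T, on F and on G ([merge_fits]).

    Dot the positions i at which i and i + 1 are on different sides of T. The condition on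
    T says that this dotting is allowable, and that T contains 1 exactly if the first dot
    is on a black square or a left half ([allowableP]). The conditions on F concern one
    position at a time: the level is prescribed, or is free, or is prescribed to be
    different from 2. A position of the last kind may carry level 1 if level 2 is possible
    at the next one, so these conditions describe the interval between a least and a
    greatest level word ([template_interval]). These two words are the levels of the sashes
    obtained from the pieces of the dotted sash by the two replacements of mystery squares
    ([lev_lowA], [lev_highA]), because the pieces and mystery squares of the first factor
    list the conditions on F in order ([items_pieces]); the same holds for G. So the cuts
    with letter set T give the product of the two intervals of the dotting ([perm_parts]),
    and the two trivial cuts give the remaining terms ([DeltaS_ends]). *)

(** * Level words *)

(** The levels 0, 1, 2 stand for a black square, the left half of a rectangle, and a
white square or right half. Positions in state 2 are those where i + 1 precedes i,
and 1 is placed in between because turning a black square into the left half of a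
rectangle also moves up in the order of sashes. *)
Definition tlev (t : tile) : seq nat :=
  match t with tb => [:: 0] | tw => [:: 2] | tr => [:: 1; 2] end.

Definition lev (C : sash) : seq nat := flatten [seq tlev t | t <- C].

Definition lv (C : sash) (p : nat) : nat := nth 0 (lev C) p.-1.

(** The words arising from sashes: a left half is always followed by a right half. *)
Fixpoint level_word (s : seq nat) : bool :=
  if s is f :: s' then
    [&& f <= 2, (f == 1) ==> (head 0 s' == 2) & level_word s']
  else true.

Lemma lev_cons t C : lev (t :: C) = tlev t ++ lev C. Proof. by []. Qed.

Lemma lev_cat C D : lev (C ++ D) = lev C ++ lev D.
Proof. by rewrite /lev map_cat flatten_cat. Qed.

Lemma lev_rcons C t : lev (rcons C t) = lev C ++ tlev t.
Proof. by rewrite -cats1 lev_cat /lev /= cats0. Qed.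

Lemma size_lev C : size (lev C) = slen C.
Proof. by elim: C => // t C IH; rewrite lev_cons size_cat IH slen_cons; case: t. Qed.

Lemma lev_inj : injective lev.
Proof. by elim=> [|[] C IH] [|[] D] //; rewrite !lev_cons => -[] /IH ->. Qed.

Lemma lev_level_word C : level_word (lev C).
Proof. by elim: C => // t C IH; rewrite lev_cons; case: t. Qed.

Lemma level_word_nth s i : level_word s ->
  nth 0 s i <= 2 /\ (nth 0 s i = 1 -> nth 0 s i.+1 = 2).
Proof.
elim: s i => [|f s IH] i; first by rewrite !nth_nil.
case/and3P=> f2 fs /IH{}IH; case: i => [|i]; last exact: IH.
by split=> //= f1; move: fs; rewrite f1 /= => /eqP <-; rewrite nth0.
Qed.

Lemma lv_le2 C p : lv C p <= 2.
Proof. by case: (level_word_nth p.-1 (lev_level_word C)). Qed.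

Lemma lv_1 C p : 0 < p -> lv C p = 1 -> lv C p.+1 = 2.
Proof. by case: p => // p _; case: (level_word_nth p (lev_level_word C)). Qed.

(** * Levels of permutations *)

(** The level of position [a] in the sash of [x] can be read off from the relative order
of [a], [a.+1], [a.+2] alone, without a recursion from the left: when [a]
carries a left half, [a.+2] precedes [a.+1] and position [a.+1] gets level 2 anyway. *)
Definition plevel (x : seq nat) (a : nat) : nat :=
  if left_of x a.+1 a then 2 else if left_of x a.+2 a then 1 else 0.

Definition levels (x : seq nat) : seq nat :=
  [seq plevel x a | a <- iota 1 (size x).-1].

Lemma is_perm_uniq x : is_perm x -> uniq x.
Proof. by move=> /perm_uniq ->; rewrite iota_uniq. Qed.

Lemma mem_is_perm x a : is_perm x -> (a \in x) = (0 < a <= size x).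
Proof. by move=> /perm_mem ->; rewrite mem_iota add1n ltnS. Qed.

Lemma left_of_trans x b a c : left_of x a b -> left_of x b c -> left_of x a c.
Proof. by rewrite /left_of; lia. Qed.

Lemma left_of_irr x a : left_of x a a = false.
Proof. by rewrite /left_of ltnn. Qed.

Lemma left_of_total x a b : a \in x -> a != b -> left_of x a b = ~~ left_of x b a.
Proof.
move=> ax ab; rewrite /left_of -leqNgt ltn_neqAle; case: eqP => // eqi.
by rewrite -(nth_index 0 ax) eqi nth_index ?eqxx // -index_mem -eqi index_mem in ab *.
Qed.

Lemma left_of_mem x a b : left_of x a b -> a \in x.
Proof. by rewrite /left_of -index_mem => /leq_trans; apply; apply: index_size. Qed.

Lemma plevel_le2 x a : plevel x a <= 2.
Proof. by rewrite /plevel; case: ifP => //; case: ifP. Qed.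

Lemma plevel_eq2 x a : (plevel x a == 2) = left_of x a.+1 a.
Proof. by rewrite /plevel; case: ifP => //; case: ifP. Qed.

(** If a + 2 precedes a and a precedes a + 1, then a + 2 precedes a + 1. *)
Lemma plevel_1 x a : plevel x a = 1 -> plevel x a.+1 = 2.
Proof.
rewrite /plevel; case: ifP => // n1; case: ifP => // h2 _.
rewrite ifT //; move: n1 h2; rewrite /left_of; lia.
Qed.

Lemma lev_sigma_rec x k i : is_perm x -> i + k = size x ->
  lev (sigma_rec x i k) = [seq plevel x j | j <- iota i k].
Proof.
move=> px; have [N] := ubnP k; elim: N k i => // N IH [|k] i // kN ik.
have -> : [seq plevel x j | j <- iota i k.+1] =
  plevel x i :: [seq plevel x j | j <- iota i.+1 k] by [].
have Li : plevel x i =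
  if left_of x i.+1 i then 2 else if left_of x i.+2 i then 1 else 0 by [].
rewrite [sigma_rec _ _ _]/=; case: ifP Li => h1 Li.
  by rewrite lev_cons IH ?Li //=; lia.
case: k kN ik => [|k] kN ik.
  rewrite Li ifF //; apply/negP => /left_of_mem; rewrite mem_is_perm //; lia.
case: ifP Li => h2 Li; last by rewrite lev_cons IH ?Li //=; lia.
by rewrite lev_cons IH /= ?Li ?(plevel_1 Li) //; lia.
Qed.

(** The sash of a nonempty permutation, without the option wrapper of [sigma]. *)
Definition sash_of (x : seq nat) : sash := sigma_rec x 1 (size x).-1.

Lemma sigmaE x : 0 < size x -> sigma x = Some (sash_of x).
Proof. by case: x. Qed.

Lemma lev_sash_of x : is_perm x -> 0 < size x -> lev (sash_of x) = levels x.
Proof. by move=> px x0; apply: lev_sigma_rec; lia. Qed.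

Lemma slen_sash_of x : is_perm x -> 0 < size x -> slen (sash_of x) = (size x).-1.
Proof. by move=> *; rewrite -size_lev lev_sash_of // size_map size_iota. Qed.

Lemma nth_levels x i : i < (size x).-1 -> nth 0 (levels x) i = plevel x i.+1.
Proof. by move=> h; rewrite (nth_map 0) ?size_iota // nth_iota. Qed.

Lemma lv_sash_of x p : is_perm x -> 0 < p < size x -> lv (sash_of x) p = plevel x p.
Proof. by move=> px hp; rewrite /lv lev_sash_of ?nth_levels ?prednK //; lia. Qed.

(** * Invariance of the levels under the projection to Pell permutations *)

Lemma left_of_swap s1 s2 a b c d : uniq (s1 ++ a :: b :: s2) ->
  (c, d) != (a, b) -> (c, d) != (b, a) ->
  left_of (s1 ++ b :: a :: s2) c d = left_of (s1 ++ a :: b :: s2) c d.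
Proof.
rewrite cat_uniq /= !inE !negb_or !xpair_eqE /left_of !index_cat /=.
move=> /and5P[_ /and3P[ha hb _] /andP[ab _] _ _].
have: (c == d) || (c != d) by case: eqP.
case/orP=> [/eqP<-|cd]; first by rewrite !ltnn.
rewrite !(eq_sym a) !(eq_sym b).
have ab' : (b == a) = false by rewrite eq_sym; apply/negbTE.
case: (boolP (c \in s1)) => cs1; case: (boolP (d \in s1)) => ds1 //;
  move: cs1 ds1; rewrite -?index_mem => cs1 ds1.
- by rewrite !ltn_addr.
- by rewrite !(leq_gtF (leq_trans (ltnW ds1) (leq_addr _ _))).
- case: (eqVneq c a) => [?|ca]; case: (eqVneq c b) => [?|cb] /=;
  case: (eqVneq d a) => [?|da]; case: (eqVneq d b) => [?|db] //=; subst;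
   rewrite ?eqxx ?ab' ?(negbTE ab) //= in cd *; lia.
Qed.

Lemma split_at x i : i.+1 < size x ->
  x = take i x ++ nth 0 x i :: nth 0 x i.+1 :: drop i.+2 x.
Proof.
move=> h; rewrite -{1}(cat_take_drop i x); congr (_ ++ _).
by rewrite (drop_nth 0) ?(drop_nth 0 h) // ltnW.
Qed.

Lemma perm_swap_at x i : i.+1 < size x -> perm_eq (swap_at x i) x.
Proof.
move=> h; rewrite {2}(split_at h) /swap_at perm_cat2l.
exact/permPl/(perm_catCA [:: _] [:: _]).
Qed.

Lemma is_perm_swap_at x i : i.+1 < size x -> is_perm x -> is_perm (swap_at x i).
Proof.
move=> h; have hp := perm_swap_at h.
by rewrite /is_perm (perm_size hp); apply: perm_trans.
Qed.

(** A reducible descent a > b never has a = b + 1, and when a = b + 2 the value b + 1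
stands to its left, so that position b has level 2 before and after the swap. *)
Lemma plevel_swap_at x i : is_perm x -> reducible x i -> plevel (swap_at x i) =1 plevel x.
Proof.
move=> px /and3P[hi ba red] p.
have ux := is_perm_uniq px.
have ex := split_at hi.
set a := nth 0 x i in ex ba red; set b := nth 0 x i.+1 in ex ba red.
have es : swap_at x i = take i x ++ b :: a :: drop i.+2 x by [].
have us := ux; rewrite ex in us.
have lo c d : (c, d) != (a, b) -> (c, d) != (b, a) ->
    left_of (swap_at x i) c d = left_of x c d.
  by move=> h1 h2; rewrite es left_of_swap // -ex.
have ai : index a x = i by rewrite index_uniq // ltnW.
have bi : index b x = i.+1 by rewrite index_uniq.
have ab1 : a != b.+1.
  apply/negP => /eqP e; case/orP: red => [/hasP[v _]|]; first by lia.
  rewrite (eq_count (a2 := pred0)) ?count_pred0 // => v /=; lia.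
rewrite /plevel lo ?xpair_eqE; try lia.
case: ifP => // h1; congr (if _ then _ else _).
have [/andP[/eqP pa /eqP pb]|ne] := boolP ((p.+2 == a) && (p == b)); last first.
  by rewrite lo ?xpair_eqE //; lia.
(* For a = b + 2 a single value lies between, so it cannot occur twice on the right. *)
suff: left_of x p.+1 p by rewrite h1.
rewrite pb /left_of bi.
case/orP: red => [/hasP[v vt hv]|].
  have <- : v = b.+1 by lia.
  by rewrite ltnS ltnW // index_ltn.
rewrite (eq_count (a2 := pred1 b.+1)); last by move=> v /=; lia.
rewrite count_uniq_mem ?drop_uniq //; lia.
Qed.

(** A termination measure: moving a larger letter to the right decreases it. *)
Fixpoint weight (s : seq nat) : nat :=
  if s is a :: s' then a * (size s).+1 + weight s' else 0.

Lemma weight_swap_at x i : reducible x i -> weight (swap_at x i) < weight x.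
Proof.
case/and3P=> hi ba _; rewrite {2}(split_at hi) /swap_at.
elim: (take i x) => [|c s IH] /=; first by nia.
have: size (s ++ [:: nth 0 x i.+1, nth 0 x i & drop i.+2 x])
    = size (s ++ [:: nth 0 x i, nth 0 x i.+1 & drop i.+2 x]) by rewrite !size_cat.
by rewrite /= in IH *; move=> ->; rewrite ltn_add2l.
Qed.

(** Both ways of failing to be Pell yield a reducible descent: if a = b + 2, then b + 1
is on the left; if a > b + 2, then b + 1 and b + 2 are either both on the right, or
one of them is on the left. *)
Lemma reducibleP x : is_perm x -> ~~ pell x -> exists i, reducible x i.
Proof.
move=> px; rewrite /pell px /= => /allPn[i]; rewrite mem_iota add0n => /andP[_ hi].
have {}hi : i.+1 < size x by lia.
have ux := is_perm_uniq px.
set a := nth 0 x i; set b := nth 0 x i.+1 => hab.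
have ex := split_at hi.
have ai : index a x = i by rewrite index_uniq // ltnW.
have bi : index b x = i.+1 by rewrite index_uniq.
have ax : a \in x by rewrite mem_nth // ltnW.
have bx : b \in x by rewrite mem_nth.
exists i; rewrite /reducible hi -/a -/b /=.
have ba : b + 1 < a by lia.
apply/andP; split; first lia.
have mem v : b < v < a -> v \in take i x \/ v \in drop i.+2 x.
  move=> hv; have: v \in x by move: ax bx; rewrite !mem_is_perm //; lia.
  rewrite {1}ex mem_cat !inE -/a -/b.
  by case/or4P=> [h|/eqP e|/eqP e|h]; [left|lia|lia|right].
have [a2|a3] := leqP a (b + 2).
  apply/orP; left; apply/hasP; exists b.+1; last lia.
  have lob : left_of x b b.+1 = false by move: hab; lia.
  have h1 : b < b.+1 < a by lia.
  have b1x : b.+1 \in x by case: (mem _ h1) => [/mem_take|/mem_drop].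
  have: index b.+1 x != i.
    by apply/eqP => e; have := nth_index 0 b1x; rewrite e -/a; lia.
  have: index b.+1 x != i.+1.
    by apply/eqP => e; have := nth_index 0 b1x; rewrite e -/b; lia.
  move: lob; rewrite /left_of bi => h2 h3 h4.
  by rewrite in_take_leq;
    [rewrite ltn_neqAle h4 -ltnS ltn_neqAle h3 leqNgt h2|exact: ltnW (ltnW hi)].
have [ht|nt] := boolP (has _ _) => //=.
have md v : b < v < a -> v \in drop i.+2 x.
  by move=> hv; case: (mem v hv) => // h; case/hasP: nt; exists v.
rewrite -size_filter (@uniq_leq_size _ [:: b.+1; b.+2]) //=.
  by rewrite inE; lia.
by move=> v; rewrite !inE mem_filter => /orP[] /eqP ->; rewrite md; lia.
Qed.

Lemma pi_down_exists x : is_perm x ->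
  exists z, [/\ pi_down x z, pell z, size z = size x & plevel z =1 plevel x].
Proof.
have [N] := ubnP (weight x); elim: N x => // N IH x wx px.
have [px'|npx] := boolP (pell x).
  by exists x; split=> //; apply: pi_down_stop.
have [i ri] := reducibleP px npx.
have hi : i.+1 < size x by case/and3P: ri.
have [|z [dz pz sz Lz]] := IH (swap_at x i) _ (is_perm_swap_at hi px).
  by apply: leq_trans (weight_swap_at ri) _.
exists z; split=> //; first exact: pi_down_step dz.
  by rewrite sz (perm_size (perm_swap_at hi)).
by move=> p; rewrite Lz (plevel_swap_at px ri).
Qed.

Lemma pi_down_plevel x z : pi_down x z -> is_perm x ->
  [/\ pell z, size z = size x & plevel z =1 plevel x].
Proof.
elim=> {x z} [x px|x i z _ ri _ IH px]; first by split.
have hi : i.+1 < size x by case/and3P: ri.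
have [pz sz Lz] := IH (is_perm_swap_at hi px).
split=> //; first by rewrite sz (perm_size (perm_swap_at hi)).
by move=> p; rewrite Lz (plevel_swap_at px ri).
Qed.

(** * Inversions of Pell permutations *)

Lemma crossing (P : pred nat) i j : i < j -> P i -> ~~ P j ->
  exists l, [/\ i <= l, l < j, P l & ~~ P l.+1].
Proof.
move=> ij Pi; elim: j ij => // j IH; rewrite ltnS leq_eqVlt.
case/orP=> [/eqP<- nPj|ij nPj]; first by exists i.
have [Pj|/IH] := boolP (P j); first by exists j; split=> //; apply: ltnW.
by case=> // l [? ? ? ?]; exists l; split=> //; lia.
Qed.

(** In a Pell permutation every inversion is a chain of elementary ones, of the form
(b, b - 1) or (b, b - 2) with a rectangle. Between the positions of b and a there is a
place where the letters pass from at least b to below b; this descent drops by at most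
2, hence lands on b - 1 or b - 2, and in the second case it starts from b itself. *)
Lemma pell_inversion x a b : pell x -> 0 < a < b -> left_of x b a ->
  (left_of x b b.-1 /\ (b.-1 == a \/ left_of x b.-1 a)) \/
  [/\ a <= b.-2, plevel x b.-2 = 1, left_of x b b.-2 & (b.-2 == a \/ left_of x b.-2 a)].
Proof.
case/andP=> px /allP pel ab lba.
have ux := is_perm_uniq px.
have bx := left_of_mem lba.
have ax : a \in x by move: bx; rewrite !mem_is_perm //; lia.
have [/eqP e|ne] := boolP (a == b.-1); first by left; rewrite -e; split=> //; left.
have [|||l [il lj Pl nPl]] := @crossing (fun l => b <= nth 0 x l) (index b x) (index a x).
- exact: lba.
- by rewrite nth_index.
- by rewrite nth_index // -ltnNge; case/andP: ab.
have jx : index a x < size x by rewrite index_mem.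
have lx : l.+1 < size x by lia.
have := pel l; rewrite mem_iota => /(_ ltac:(lia)).
set c := nth 0 x l in Pl *; set d := nth 0 x l.+1 in nPl * => /andP[cd hcd].
have di : index d x = l.+1 by rewrite index_uniq.
have da : d == a \/ left_of x d a.
  have [->|dna] := eqVneq d a; [by left|right].
  rewrite /left_of di ltn_neqAle lj andbT -di; apply/eqP => e.
  move/eqP: dna; apply; rewrite -(nth_index 0 ax) -e nth_index // mem_nth //.
have bd : left_of x b d by rewrite /left_of di ltnS.
have [e|e] : d = b.-1 \/ d = b.-2 by lia.
  by left; rewrite -e.
right; rewrite -e; split=> //; first by lia.
have ecb : c = b by lia.
move: hcd; have -> : c == d + 2 by lia.
move=> /= hd; rewrite /plevel ifF; last by move: hd; rewrite /left_of; lia.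
by rewrite ifT //; have -> : d.+2 = b by lia.
Qed.

Lemma pell_is_perm x : pell x -> is_perm x. Proof. by case/andP. Qed.

(** By [pell_inversion] it suffices to transport elementary inversions, which the levels
control: a pair (b, b - 2) inverted in [x] remains inverted in [y] because its level at
b - 2 is at least 1 while the level at b - 1 is 2. *)
Lemma pell_left_of x y : pell x -> is_perm y ->
  (forall p, 0 < p < size x -> plevel x p <= plevel y p) ->
  forall a b, 0 < a < b -> left_of x b a -> left_of y b a.
Proof.
move=> px py hL a b; have [N] := ubnP (b - a); elim: N b => // N IH b bN ab lba.
have pp := pell_is_perm px.
have := left_of_mem lba; rewrite mem_is_perm // => bx.
have e1 : b = b.-1.+1 by lia.
have two p : 0 < p < size x -> left_of x p.+1 p -> left_of y p.+1 p.
  by move=> hp h; have := hL p hp; rewrite -plevel_eq2 {1}/plevel h;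
    have := plevel_le2 y p; lia.
have trans c : a <= c < b -> c == a \/ left_of x c a -> left_of y b c -> left_of y b a.
  move=> hc [/eqP -> //|h] h2; apply: left_of_trans h2 _; apply: IH => //; try lia.
  have: c != a; last by lia.
  by apply: contraTneq h => ->; rewrite left_of_irr.
case: (pell_inversion px ab lba) => [[h1 h2]|[ab2 h1 h2 h3]].
  apply: (trans b.-1 _ h2); first lia.
  by rewrite {1}e1; apply: two; rewrite -?e1 //; lia.
have e2 : b = b.-2.+2 by lia.
apply: (trans b.-2 _ h3); first lia.
have hb : left_of x b.-2.+2 b.-2.+1 by rewrite -plevel_eq2 (plevel_1 h1).
have {}hb := two b.-2.+1 _ hb; rewrite -e2 in hb.
have: 0 < plevel y b.-2 by rewrite -{1}h1; apply: hL; lia.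
rewrite /plevel; case: ifP => h4.
  by move=> _; apply: left_of_trans h4; apply: hb; lia.
by rewrite -e2; case: ifP.
Qed.

Lemma left_of_plevel x y : is_perm x -> size x = size y -> is_perm y ->
  (forall a b, 0 < a < b -> left_of x b a -> left_of y b a) ->
  forall p, 0 < p -> plevel x p <= plevel y p.
Proof.
move=> px sxy py h p p0; rewrite {1}/plevel.
case: ifP => h1; first by rewrite /plevel h //; lia.
case: ifP => // h2.
by rewrite /plevel; case: ifP => // _; rewrite h //; lia.
Qed.

(** * The weak order on Pell permutations and on sashes *)

Lemma mem_inversions x a b :
  ((b, a) \in inversions x) = [&& a < b, left_of x b a & a \in x].
Proof.
rewrite mem_filter /= -andbA; congr (_ && _).
case lba: (left_of x b a) => //=.
apply/allpairsP/idP => [[[u v] /= [? vx [_ ->]]] //|ax].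
by exists (b, a); split=> //=; apply: left_of_mem lba.
Qed.

Lemma weak_le_pell x y : pell x -> is_perm y -> size x = size y ->
  weak_le x y <-> (forall p, 0 < p < size x -> plevel x p <= plevel y p).
Proof.
move=> px py sxy; have pp := pell_is_perm px; split.
  move=> /allP h p hp; apply: left_of_plevel => //; last lia.
  move=> a b ab lba.
  have [ax|nax] := boolP (a \in x).
    by have := h (b, a); rewrite /= !mem_inversions lba ax => /(_ ltac:(lia)) /and3P[].
  rewrite /left_of; have := left_of_mem lba; rewrite !mem_is_perm // in nax * => hb.
  have: index b y < size y by rewrite index_mem mem_is_perm //; lia.
  by rewrite [index a y]memNindex // mem_is_perm //; lia.
move=> h; apply/allP => -[b a]; rewrite /= !mem_inversions => /and3P[ab lba ax].
have a0 : 0 < a by move: ax; rewrite mem_is_perm //; lia.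
apply/and3P; split=> //; last by rewrite mem_is_perm // -sxy -mem_is_perm.
by apply: pell_left_of px py h _ _ _ lba; rewrite a0.
Qed.

Lemma sorted_left_of x : uniq x -> sorted (left_of x) x.
Proof.
move=> ux; apply/(sortedP 0) => i hi.
by rewrite /left_of !index_uniq // ltnW.
Qed.

(** Equal levels give the same inversions, hence the same relative order of all letters. *)
Lemma pell_inj x y : pell x -> pell y -> size x = size y ->
  (forall p, 0 < p < size x -> plevel x p = plevel y p) -> x = y.
Proof.
move=> px py sxy h.
have [pp qq] := (pell_is_perm px, pell_is_perm py).
have h1 a b : 0 < a < b -> left_of x b a = left_of y b a.
  move=> ab; apply/idP/idP; apply: pell_left_of => // p hp; rewrite h //; lia.
have mxy : x =i y by move=> a; rewrite !mem_is_perm // sxy.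
have h2 a b : a \in y -> b \in y -> left_of x a b = left_of y a b.
  move=> ay by_; have [ax bx] : a \in x /\ b \in x by rewrite !mxy.
  have a0 : 0 < a by move: ay; rewrite mem_is_perm //; lia.
  have b0 : 0 < b by move: by_; rewrite mem_is_perm //; lia.
  have [ab|ab|->] := ltngtP a b; last by rewrite !left_of_irr.
    rewrite (left_of_total ax) ?(left_of_total ay) ?h1 ?a0 //; lia.
  by rewrite h1 // b0.
apply: (@irr_sorted_eq _ (left_of x)) => //.
- by move=> b a c; apply: left_of_trans.
- exact: left_of_irr.
- exact/sorted_left_of/is_perm_uniq.
apply/(sortedP 0) => i hi; rewrite h2 ?mem_nth //; last by apply: ltnW.
by have/(sortedP 0)/(_ i hi) := sorted_left_of (is_perm_uniq qq).
Qed.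

Lemma plevel_of_levels x y : size x = size y -> levels x = levels y ->
  forall p, 0 < p < size x -> plevel x p = plevel y p.
Proof.
move=> sxy e p hp; have: nth 0 (levels x) p.-1 = nth 0 (levels y) p.-1 by rewrite e.
by rewrite !nth_levels; try lia; rewrite prednK //; lia.
Qed.

Lemma pell_sash_of_inj x y : pell x -> pell y -> 0 < size x -> size x = size y ->
  sash_of x = sash_of y -> x = y.
Proof.
move=> px py x0 sxy e; apply: pell_inj => //; apply: plevel_of_levels => //.
by rewrite -!lev_sash_of ?e ?pell_is_perm -?sxy.
Qed.

(** Relative positions survive an injective relabelling and the addition of unrelated
letters at both ends, also for letters that do not occur at all. *)
Lemma left_of_embed (f : nat -> nat) s1 s2 x a b : injective f ->
  f a \notin s1 ++ s2 -> f b \notin s1 ++ s2 ->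
  left_of (s1 ++ map f x ++ s2) (f a) (f b) = left_of x a b.
Proof.
move=> fI; rewrite !mem_cat !negb_or => /andP[a1 a2] /andP[b1 b2].
have ind c : f c \notin s1 -> f c \notin s2 -> index (f c) (s1 ++ map f x ++ s2) =
    size s1 + if c \in x then index c x else size x + size s2.
  move=> c1 c2; rewrite !index_cat (negbTE c1) mem_map // index_map //.
  by rewrite [index _ s2]memNindex // size_map.
rewrite /left_of !ind // ltn_add2l.
case: (boolP (a \in x)) => ax; case: (boolP (b \in x)) => bx //.
- by move: ax; rewrite -index_mem (memNindex bx) => h; rewrite ltn_addr ?h.
- by move: bx; rewrite -index_mem (memNindex ax) => /ltnW h;
    rewrite (leq_gtF h) (leq_gtF (leq_trans h (leq_addr _ _))).
- by rewrite (memNindex ax) (memNindex bx) !ltnn.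
Qed.

(** A permutation with prescribed levels is built by adding small letters to one for the
tail of the sash: 1 in front for a black square, 1 at the end for a white square, and
the word 1 2 at the end for a rectangle. *)
Lemma levels_perm_exists C :
  exists y, [/\ is_perm y, size y = (slen C).+1 & levels y = lev C].
Proof.
have [N] := ubnP (slen C); elim: N C => // N IH [|t C] CN; first by exists [:: 1].
have [|y [py sy ly]] := IH C.
  by move: CN; rewrite slen_cons; case: t => /=; lia.
have y1 : 1 \in y by rewrite mem_is_perm // sy.
have pS m : perm_eq (map (addn m) y) (iota (m + 1) (size y)).
  by rewrite iotaDl perm_map.
have LS m s1 s2 : all (leq^~ m) (s1 ++ s2) -> forall p, 0 < p ->
    plevel (s1 ++ map (addn m) y ++ s2) (m + p) = plevel y p.
  move=> /allP hs p p0.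
  have ns c : 0 < c -> m + c \notin s1 ++ s2 by move=> c0; apply/negP => /hs; lia.
  by rewrite /plevel -!addnS !left_of_embed // ?ns //; apply: addnI.
have ind m s1 s2 : all (leq^~ m) (s1 ++ s2) ->
    index m.+1 (s1 ++ map (addn m) y ++ s2) = size s1 + index 1 y.
  move=> /allP hs; have ns : m.+1 \notin s1 by apply/negP => h; have := hs m.+1;
    rewrite mem_cat h => /(_ isT); lia.
  rewrite !index_cat (negbTE ns) -addn1 mem_map ?y1; last exact: addnI.
  by rewrite index_map //; apply: addnI.
have tail m s1 s2 : all (leq^~ m) (s1 ++ s2) ->
  [seq plevel (s1 ++ map (addn m) y ++ s2) p | p <- iota m.+1 (slen C)] = lev C.
  move=> hs; rewrite -ly /levels sy /= -(addn1 m) iotaDl -map_comp.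
  by apply/eq_in_map => p; rewrite mem_iota => hp /=; rewrite LS //; lia.
have iy : index 1 y < size y by rewrite index_mem.
case: t CN => CN.
- exists ([:: 1] ++ map (addn 1) y ++ [::]); split.
  + rewrite /is_perm cats0 /= size_map perm_cons; exact: pS.
  + by rewrite cats0 /= size_map sy.
  rewrite /levels lev_cons -(tail 1 [:: 1] [::]) // size_cat size_cat size_map sy /=
    addn0 /=.
  congr (_ :: _); rewrite /plevel /left_of /= ltnn ltn0 //.
- exists ([::] ++ map (addn 1) y ++ [:: 1]); split.
  + by rewrite /is_perm /= size_cat size_map addn1 perm_catC /= perm_cons; exact: pS.
  + by rewrite /= size_cat size_map sy slen_cons addn1.
  rewrite /levels lev_cons -(tail 1 [::] [:: 1]) // size_cat size_cat size_map sy /=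
    addn1 /=.
  congr (_ :: _); apply/eqP; rewrite plevel_eq2 /left_of (ind 1 [::] [:: 1]) //.
  rewrite index_cat size_map ifF; first by rewrite /= addn0.
  by apply/mapP => -[z]; rewrite mem_is_perm //; lia.
- exists ([::] ++ map (addn 2) y ++ [:: 1; 2]); split.
  + by rewrite /is_perm /= size_cat size_map addn2 perm_catC /= !perm_cons; exact: pS.
  + by rewrite /= size_cat size_map sy slen_cons addn2.
  rewrite /levels lev_cons -(tail 2 [::] [:: 1;
    2]) // size_cat size_cat size_map sy /= addn2 /=.
  have i1 c : 0 < c <= 2 -> index c (map (addn 2) y ++ [:: 1; 2]) = size y + c.-1.
    move=> hc; rewrite index_cat size_map ifF.
      by case: c hc => [|[|[|c]]].
    by apply/mapP => -[z]; rewrite mem_is_perm //; lia.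
  have i3 := ind 2 [::] [:: 1; 2] isT; rewrite !cat0s in i3.
  have L1 : plevel (map (addn 2) y ++ [:: 1; 2]) 1 = 1.
    by rewrite /plevel /left_of (i1 1) // (i1 2) // i3 ifF ?ifT //; move: iy => /=; lia.
  by rewrite L1 (plevel_1 L1).
Qed.

(** Existence only requires some permutation with the given sash, since the projection to
Pell permutations preserves levels. *)
Lemma etaP C : [/\ pell (Defs.eta C), size (Defs.eta C) =
  (slen C).+1 & sigma (Defs.eta C) = Some C].
Proof.
have [y [py sy ly]] := levels_perm_exists C.
have [z [_ pz sz Lz]] := pi_down_exists py.
have zC : sigma z = Some C.
  rewrite sigmaE ?sz ?sy //; congr Some; apply: lev_inj.
  rewrite lev_sash_of ?sz ?sy ?pell_is_perm // -ly /levels sz.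
  by apply/eq_map.
have: z \in [seq x <- permutations (iota 1 (slen C).+1) | pell x && (sigma x == Some C)].
  rewrite mem_filter pz zC eqxx mem_permutations -sy -sz.
  by have := pell_is_perm pz.
rewrite /Defs.eta; set s := filter _ _ => zs.
have: head [::] s \in s by case: s zs => //= u s _; rewrite mem_head.
rewrite mem_filter mem_permutations => /andP[/andP[-> /eqP ->] /perm_size ->].
by rewrite size_iota.
Qed.

Lemma eta_sash_of x : pell x -> 0 < size x -> Defs.eta (sash_of x) = x.
Proof.
move=> px x0; have [pe se ee] := etaP (sash_of x); have pp := pell_is_perm px.
apply: pell_sash_of_inj => //; rewrite ?se ?slen_sash_of ?prednK //.
by move: ee; rewrite sigmaE ?se // => -[].
Qed.

Lemma sash_of_eta C : sash_of (Defs.eta C) = C.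
Proof. by have [pe se] := etaP C; rewrite sigmaE ?se // => -[]. Qed.

Lemma levels_eta C : levels (Defs.eta C) = lev C.
Proof. by have [pe se _] := etaP C;
  rewrite -lev_sash_of ?sash_of_eta ?se ?pell_is_perm. Qed.

Lemma sash_leE C D : slen C = slen D -> sash_le C D = all2 leq (lev C) (lev D).
Proof.
move=> sCD; have [[pC sC _] [pD sD _]] := (etaP C, etaP D).
have H := weak_le_pell pC (pell_is_perm pD) _; rewrite sC sD sCD in H.
rewrite all2E !size_lev sCD eqxx -!levels_eta /levels sC sD sCD /= zip_map all_map.
apply/idP/allP => [/H h p|h]; first by rewrite mem_iota => hp; apply: h; lia.
by apply/H => // p hp; apply: h; rewrite mem_iota; lia.
Qed.

(** Both directions rest on the invariance of levels: every permutation projects to some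
Pell permutation with the same sash, and there is only one. *)
Lemma pi_downE y z : is_perm y -> pell z -> size y = size z ->
  `[< pi_down y z >] = (sigma y == sigma z).
Proof.
move=> py pz syz; apply/asboolP/eqP => [/pi_down_plevel/(_ py)[_ szy Lzy]|e].
  case: y z => [|u y] [|v z] // in py pz syz szy Lzy *.
  rewrite !sigmaE //; congr Some; apply: lev_inj; rewrite !lev_sash_of //;
    last exact: pell_is_perm.
  by rewrite /levels syz; apply/eq_map => p; rewrite Lzy.
have [z' [dz' pz' sz' Lz']] := pi_down_exists py.
have [y0|] := posnP (size y).
  suff e' : z = z' by rewrite e'.
  by move: y0 sz' syz; case: (y) (z) (z') => [|? ?] [|? ?] [|? ?].
move=> y0; suff e' : z = z' by rewrite e'.
have z0 : 0 < size z by rewrite -syz.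
apply: pell_inj; rewrite ?sz' ?syz // => p hp; rewrite Lz'; apply: plevel_of_levels => //.
rewrite -!lev_sash_of //; last exact: pell_is_perm.
by move: e; rewrite !sigmaE // => -[] ->.
Qed.

(** * Intervals of level words cut out by templates *)

(** An interval of sashes is described position by position: [Exact v] prescribes the
level, [Low] forbids level 2, and [Free] leaves the level open. *)
Variant item := Low | Exact of nat | Free.

Definition sat (i : item) (f : nat) : bool :=
  match i with Low => f != 2 | Exact v => f == v | Free => true end.

Definition low (i : item) : nat := if i is Exact v then v else 0.

(** Where level 2 is forbidden, the largest choice is 1 exactly if the next position can
carry the matching right half. *)
Fixpoint high (M : seq item) : seq nat :=
  match M with
  | [::] => [::]
  | i :: M' => let h := high M' in
    match i with
    | Low => nat_of_bool (head 0 h == 2)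
    | Exact v => v
    | Free => 2
    end :: h
  end.

Definition bounded (i : item) : bool := if i is Exact v then v <= 2 else true.

Lemma size_high M : size (high M) = size M.
Proof. by elim: M => //= i M ->. Qed.

Lemma high_le2 M : all bounded M -> head 0 (high M) <= 2.
Proof. by case: M => [|[|v|] M] //=; [case: (_ == 2)|case/andP]. Qed.

(** The conditions [sat] cut out an interval of level words: a level 1 at a [Low] position
forces level 2 next to it, so that the bound of [high] at this position is 1 as well. *)
Lemma template_interval M F : level_word F -> size F = size M -> all bounded M ->
  all2 leq (map low M) F && all2 leq F (high M) = all2 sat M F.
Proof.
elim: M F => [|i M IH] [|f F] //= /and3P[f2 f1 vF] [sF] /andP[bi bM].
rewrite -(IH F) //; move: (high_le2 bM) f1.
have -> : all2 leq F (high M) = all2 leq F (high M) && (head 0 F <= head 0 (high M)).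
  by case: (F) (high M) => [|u F'] [|v M'] //=; case: (u <= v) => //=; rewrite andbT.
move: (all2 _ _ F) (all2 _ F _) (head 0 F) (head 0 (high M)) => a b h k.
case: i bi => [|v|] /= bi k2; case: a; case: b => //=; rewrite ?andbF //.
- by rewrite implybE; case: (altP (k =P 2)) => [->|k2'] /=; lia.
- by rewrite implybE; lia.
- by rewrite implybE; lia.
Qed.

(** The template of a word with mystery squares. A black square followed by a mystery
square is only known not to be white, as both may merge into a rectangle; at the end of
the word [Low] and [Exact 0] impose the same condition on level words. *)
Fixpoint items (fl : nat -> item) (s : seq mtile) : seq item :=
  match s with
  | [::] => [::]
  | Tile tb :: s' => (if s' is Tile _ :: _ then Exact 0 else Low) :: items fl s'
  | Tile tw :: s' => Exact 2 :: items fl s'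
  | Tile tr :: s' => Exact 1 :: Exact 2 :: items fl s'
  | Mystery i :: s' => fl i :: items fl s'
  end.

Lemma lev_low fl g s : (forall i, tlev (g i) = [:: low (fl i)]) ->
  lev [seq match q with Tile t => t | Mystery i => g i end | q <- s] = map low (items fl s).
Proof.
move=> h; elim: s => //= -[t|i] s; rewrite lev_cons => ->; last by rewrite h.
by case: t => //=; case: s => // -[].
Qed.

(** A mystery square of the first factor stands between two neighbouring letters of its set
that are not consecutive integers. If they are q and q + 2, position q of the sash records
which of them comes first; otherwise it records nothing about them. *)
Definition flagA C d i : item :=
  if same_rectangle C d i then Exact 2 else
  if black_then_white C d i then Low else Free.

Definition flagB (i : nat) : item := Free.

Lemma lev_lowA C d : lev (lowA C d) = map low (items (flagA C d) (mA C d)).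
Proof.
rewrite -(lev_low _ (g := fun i => if same_rectangle C d i then tw else tb)) // => i.
by rewrite /flagA; case: ifP => //; case: ifP.
Qed.

Lemma lev_lowB C d : lev (lowB C d) = map low (items flagB (mB C d)).
Proof. by rewrite -(lev_low _ (g := fun i => tb)). Qed.

Lemma flagA_high C d i : black_then_white C d i = false ->
  forall M, high (flagA C d i :: M) = 2 :: high M.
Proof. by rewrite /flagA => ->; case: ifP. Qed.

Lemma flagA_btw C d i : black_then_white C d i -> flagA C d i = Low.
Proof.
rewrite /flagA => h; rewrite h ifF //.
by case/and3P: h => /eqP h _ _; rewrite /same_rectangle h.
Qed.

(* levels contributed by acc once the next item may turn its final black square
   into the left half of a rectangle *)
(** The invariant of [highA_rec]: the levels of the accumulator, except that its final black
square already counts as a left half if the next mystery square is going to absorb it. *)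
Definition settled fl (acc : sash) (s : seq mtile) : seq nat :=
  if [&& last tw acc == tb, (if s is Mystery _ :: _ then true else false)
       & head 0 (high (items fl s)) == 2]
  then rcons (lev (take (size acc).-1 acc)) 1 else lev acc.

Lemma settled_rcons fl acc t s : t != tb -> settled fl (rcons acc t) s = lev (rcons acc t).
Proof. by rewrite /settled last_rcons; case: eqP. Qed.

Lemma settled_tb fl acc s : settled fl (rcons acc tb) s =
  rcons (lev acc) ((if s is Mystery _ :: _ then true else false) &&
                   (head 0 (high (items fl s)) == 2)).
Proof.
rewrite /settled last_rcons eqxx size_rcons /=.
have -> : take (size acc) (rcons acc tb) = acc by rewrite -cats1 take_size_cat.
by rewrite lev_rcons cats1; case: ifP => // ->.
Qed.

Lemma nat_of_bool_neq2 (b : bool) : (nat_of_bool b == 2) = false. Proof. by case: b. Qed.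

(** The left-to-right rewriting of mystery squares computes the maximum [high], which looks
one position ahead: a black square becomes a left half precisely when the mystery square
after it can be white, and the mystery square of an adjacent black and white pair becomes a
left half when a white square follows. *)
Lemma lev_highA_rec C d acc s :
  lev (highA_rec C d acc s) =
  settled (flagA C d) acc s ++ high (items (flagA C d) s).
Proof.
have [N] := ubnP (size s); elim: N s acc => // N IH [|[t|i] s] acc sN.
- by rewrite /settled /= andbF cats0.
- rewrite {1}/settled andbF [highA_rec _ _ _ _]/= IH //.
  case: t {sN}; last 2 first.
  + by rewrite settled_rcons // lev_rcons -catA.
  + by rewrite settled_rcons // lev_rcons -catA.
  rewrite settled_tb -cats1 -catA; congr (_ ++ _).
  by case: s => [|[]].
rewrite [highA_rec _ _ _ _]/=; case: ifP => hb; last first.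
  have hh := flagA_high hb; rewrite [items _ _]/= hh /settled [items _ _]/= hh /=.
  case: ifP => hl; rewrite IH // settled_rcons // lev_rcons -catA -?cats1 -?catA //.
have hi := flagA_btw hb.
have -> : settled (flagA C d) acc (Mystery i :: s) = lev acc.
  by rewrite /settled /= hi /=; case: (head 0 _ == 2); rewrite ?andbF.
have base : lev (highA_rec C d (rcons acc tb) s) = rcons (lev acc)
   ((if s is Mystery _ :: _ then true else false) &&
                   (head 0 (high (items (flagA C d) s)) == 2)) ++ high (items (flagA C d)
                     s).
  by rewrite IH // settled_tb.
rewrite [items _ _]/= hi [high _]/=.
case: s sN base => [|[[]|j] s] sN base; rewrite ?base -?cats1 -?catA //.
- congr (_ ++ (_ :: _)); rewrite /=; case: s {sN base} => [|[t|j] s] //=.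
  by rewrite (nat_of_bool_neq2 (_ == 2)).
- rewrite cats1 IH; last by apply: ltnW.
  by rewrite settled_rcons // lev_rcons -catA.
Qed.

Lemma lev_highA C d : lev (highA C d) = high (items (flagA C d) (mA C d)).
Proof. by rewrite /highA lev_highA_rec. Qed.

Lemma lev_highB C d : lev (highB C d) = high (items flagB (mB C d)).
Proof.
rewrite /highB; have [N] := ubnP (size (mB C d)).
elim: N (mB C d) => // N IH [|[[]|i] s] //= sN.
- case: s sN => [|[t|i] s] sN //.
    by rewrite lev_cons IH.
  by rewrite lev_cons IH //; apply: ltnW.
- by rewrite lev_cons IH.
- by rewrite lev_cons IH.
- by rewrite lev_cons IH.
Qed.

(** * Pieces of a dotted sash as templates *)

Definition clev (c : cell) : nat :=
  match c with CB => 0 | CL => 1 | _ => 2 end.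

Lemma cells_cons t C : cells (t :: C) =
  match t with tb => [:: CB] | tw => [:: CW] | tr => [:: CL; CR] end ++ cells C.
Proof. by []. Qed.

Lemma lev_cells C : lev C = map clev (cells C).
Proof.
by elim: C => // t C IH; rewrite lev_cons cells_cons map_cat -IH; case: t.
Qed.

Lemma size_cells C : size (cells C) = slen C.
Proof. by rewrite -size_lev lev_cells size_map. Qed.

Lemma cell_left C k : nth CW (cells C) k = CL -> nth CW (cells C) k.+1 = CR.
Proof.
elim: C k => [|t C IH] k; first by rewrite nth_nil.
by rewrite cells_cons; case: t => /=; case: k => [|[|k]] //=; apply: IH.
Qed.

Lemma cell_right C k : nth CW (cells C) k.+1 = CR -> nth CW (cells C) k = CL.
Proof.
elim: C k => [|t C IH] k; first by rewrite nth_nil.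
have h0 : nth CW (cells C) 0 <> CR by case: C {IH} => [|[]].
rewrite cells_cons; case: t => /=; last by case: k => [|[|k]] //= /IH.
  by case: k => [/h0|k /IH].
by case: k => [/h0|k /IH].
Qed.

Definition closed_left (s : seq cell) : Prop :=
  forall k, k.+1 < size s -> nth CW s k = CL -> nth CW s k.+1 = CR.

Fixpoint cell_items (s : seq cell) : seq item :=
  if s is x :: s' then
    (if s' is [::] then (if clev x == 2 then Exact 2 else Low)
     else Exact (clev x)) :: cell_items s'
  else [::].

Lemma cell_itemsE s : cell_items s =
  mkseq (fun k => let v := clev (nth CW s k) in
     if k.+1 < size s then Exact v else if v == 2 then Exact 2 else Low) (size s).
Proof.
elim: s => //= x s ->; rewrite /mkseq /= -[1]addn0 iotaDl -map_comp.
by case: s => //= y s; congr [:: _, _ & _].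
Qed.

(** A left half that ends the piece has become a black square before a mystery square or
the end, so its item is [Low], as for an honest black square there. *)
Lemma items_tiles fl s r : closed_left s ->
  (if r is Tile _ :: _ then false else true) ->
  items fl (map Tile (tiles_of s) ++ r) = cell_items s ++ items fl r.
Proof.
have [N] := ubnP (size s); elim: N s => // N IH [|x s] // sN cs hr.
have cs' : closed_left s by move=> k; apply: (cs k.+1).
have IHs := IH s sN cs' hr.
case: x cs sN => cs sN /=.
- rewrite -IHs; case: s {sN cs IHs cs'} => [|y s]; first by case: r hr {IH} => [|[]].
  by rewrite /=; case: y; case: s => [|[] s].
- by rewrite -IHs; case: s {sN cs IHs cs'}.
- case: s cs sN IHs cs' => [|y s] cs sN IHs cs'.
    by case: r hr {IH IHs} => [|[]].
  have ey : y = CR by apply: (cs 0).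
  rewrite ey /= IH //; first by case: s {cs sN IHs cs'}.
    by apply: ltnW.
  by move=> k; apply: (cs k.+2).
- by rewrite -IHs; case: s {sN cs IHs cs'}.
Qed.

(** * Positions of the dots *)

Lemma size_dots d : size (dots d) = count id d.
Proof.
rewrite /dots size_filter -{3}(mkseq_nth false d) /mkseq count_map.
by rewrite -[1]addn0 iotaDl count_map; apply: eq_count => k /=.
Qed.

(** The number of dots among the first [p] positions. The same function serves for the rank
of a letter within a set of letters given by its characteristic word. *)
Definition cnt (d : bitseq) (p : nat) : nat := count id (take p d).

Lemma cntS d p : cnt d p.+1 = nth false d p + cnt d p.
Proof.
rewrite /cnt; have [pd|pd] := ltnP p (size d).
  by rewrite (take_nth false) // -cats1 count_cat /= addn0 addnC.
by rewrite nth_default // !take_oversize //; lia.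
Qed.

Lemma leq_cnt d : {homo cnt d : p q / p <= q}.
Proof.
move=> p q /subnK <-; elim: (q - p) => //= k IH.
by apply: leq_trans IH _; rewrite addSn cntS leq_addl.
Qed.

Lemma cnt_size d p : size d <= p -> cnt d p = size (dots d).
Proof. by move=> h; rewrite size_dots /cnt take_oversize. Qed.

Lemma dots_cat d1 d2 : dots (d1 ++ d2) = dots d1 ++ map (addn (size d1)) (dots d2).
Proof.
rewrite /dots size_cat iotaD filter_cat; congr (_ ++ _).
  by apply: eq_in_filter => p; rewrite mem_iota nth_cat => hp; rewrite ifT //; lia.
rewrite addnC iotaDl filter_map; congr map; apply: eq_in_filter => p.
rewrite mem_iota => hp /=; rewrite nth_cat ifF; last lia.
by congr nth; lia.
Qed.

Lemma dots_nth d p : 0 < p -> nth false d p.-1 ->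
  nth (size d).+1 (dots d) (cnt d p.-1) = p.
Proof.
case: p => // p _ /= dp; have pd : p < size d.
  by rewrite ltnNge; apply/negP => h; rewrite nth_default in dp.
rewrite -{2}(cat_take_drop p d) (drop_nth false) // dp dots_cat nth_cat size_dots.
by rewrite ltnn subnn /= size_take pd addn1.
Qed.

Lemma mem_dots d p : (p \in dots d) = [&& 0 < p, p <= size d & nth false d p.-1].
Proof. by rewrite mem_filter mem_iota; lia. Qed.

Lemma dots_uniq d : uniq (dots d). Proof. by rewrite filter_uniq ?iota_uniq. Qed.

Lemma dot_pos_mem d i : 0 < i <= size (dots d) -> dot_pos d i \in dots d.
Proof. by case: i => // i hi; rewrite /dot_pos /= mem_nth. Qed.

Lemma dot_pos_over d i : size (dots d) < i -> dot_pos d i = (size d).+1.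
Proof. by case: i => // i hi; rewrite /dot_pos /= nth_default. Qed.

Lemma cnt_dot_pos d i : i < size (dots d) -> cnt d (dot_pos d i.+1).-1 = i.
Proof.
move=> hi; have := @dot_pos_mem d i.+1; rewrite hi => /(_ isT).
rewrite mem_dots => /and3P[p0 pd dp]; have := dots_nth p0 dp.
set k := cnt _ _; move=> e.
have kd : k < size (dots d).
  by rewrite ltnNge; apply/negP => h; move: e; rewrite nth_default //; lia.
by apply/eqP; rewrite -(nth_uniq (size d).+1 kd hi (dots_uniq d)) e.
Qed.

Lemma dot_pos_bit d i : i < size (dots d) ->
  0 < dot_pos d i.+1 <= size d /\ nth false d (dot_pos d i.+1).-1.
Proof.
move=> hi; have := @dot_pos_mem d i.+1; rewrite hi => /(_ isT).
by rewrite mem_dots => /and3P[-> -> ->].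
Qed.

Lemma dot_pos_lb d i p : p < dot_pos d i.+1 -> cnt d p <= i.
Proof.
have [hi|hi] := ltnP i (size (dots d)).
  by move=> hp; rewrite -(cnt_dot_pos hi); apply: leq_cnt; lia.
by move=> _; rewrite (leq_trans _ hi) // -(@cnt_size d (p + size d)) ?leq_cnt //; lia.
Qed.

Lemma dot_pos_ub d i p : i <= size (dots d) -> dot_pos d i <= p -> i <= cnt d p.
Proof.
case: i => // i hi hp; have [h1 h2] := dot_pos_bit hi.
have := leq_cnt d hp; rewrite -(prednK (n := dot_pos d i.+1)) ?cntS ?h2 ?cnt_dot_pos //;
  lia.
Qed.

Lemma dot_pos0 d : dot_pos d 0 = 0. Proof. by []. Qed.

Lemma dot_pos_lt d i : i <= size (dots d) -> dot_pos d i < dot_pos d i.+1.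
Proof.
move=> hi; rewrite ltnNge; apply/negP => h.
have [hj|hj] := ltnP i (size (dots d)).
  have [h1 h2] := dot_pos_bit hj.
  have := dot_pos_ub hj h; case: i hi h hj h1 h2 => [|i] hi h hj h1 h2.
    by move: h h1; rewrite dot_pos0; lia.
  have [h3 h4] := dot_pos_bit hi.
  rewrite -(prednK (n := dot_pos d i.+1)) ?cntS ?h4 ?cnt_dot_pos //; lia.
move: h; rewrite (@dot_pos_over d i.+1) //.
case: i hi hj => [|i] hi hj; first by rewrite /dot_pos.
by have [] := dot_pos_bit hi; lia.
Qed.

Lemma cnt_between d i p : i <= size (dots d) -> dot_pos d i <= p < dot_pos d i.+1 ->
  cnt d p = i.
Proof.
by move=> hi /andP[h1 h2]; apply/eqP; rewrite eqn_leq dot_pos_lb ?dot_pos_ub.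
Qed.

(** * The template of one tensor factor *)

(** Letters and positions are numbered from 1, entries of words from 0. *)
Definition bit (t : bitseq) (p : nat) : bool := nth false t p.-1.

(** Whether the set contains an element greater than [p]. *)
Definition later (t : bitseq) (p : nat) : bool := true \in drop p t.

(** The elements that have a successor in the set: they index the positions of the sash of
a word with these letters. *)
Definition nonlast (t : bitseq) : seq nat :=
  [seq p <- iota 1 (size t).-1 | bit t p && later t p].

(** The condition that position [p] of [c] puts on one factor, if [p] belongs to the factor.
Two consecutive letters p, p + 1 of the factor fix whether the level is 2; the third
letter p + 2 fixes the level completely. If p + 1 belongs to the other factor, the
condition is [my p]. *)
Definition pos_item (c : nat -> nat) (my : nat -> item) (t : bitseq) (p : nat) : item :=
  if bit t p.+1 then
    if bit t p.+2 then Exact (c p) else if c p == 2 then Exact 2 else Low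
  else my p.

Lemma laterP t p : reflect (exists2 q, p < q & bit t q) (later t p).
Proof.
apply: (iffP (nthP false)) => [[k hk e]|[q pq hq]].
  exists (p + k).+1; first lia.
  by rewrite /bit /= -nth_drop e.
have qt : q.-1 < size t by rewrite ltnNge; apply/negP => h; rewrite /bit nth_default in hq.
exists (q.-1 - p); first by rewrite size_drop ltn_sub2r // (leq_ltn_trans _ qt) //; lia.
by rewrite nth_drop subnKC; last lia.
Qed.

Section Pieces.
Variables (C : sash) (d t : bitseq) (e : bool) (my fl : nat -> item).
Hypothesis dC : size d = slen C.
Hypothesis td : size t = (size d).+1.
Hypothesis tE : forall p, 0 < p <= (size d).+1 -> bit t p = (odd (cnt d p.-1).+1 == e).
Hypothesis flE : forall i, odd i == e -> 0 < i < size (dots d) -> fl i = my (dot_pos d i).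

Local Notation m := (size d).
Local Notation j := (size (dots d)).
Local Notation IT := (pos_item (lv C) my t).

Let bit_over p : m.+1 < p -> bit t p = false.
Proof. by move=> hp; rewrite /bit nth_default // td; lia. Qed.

Let bit_seg i p : i <= j -> dot_pos d i < p <= dot_pos d i.+1 -> p <= m.+1 ->
  bit t p = (odd i.+1 == e).
Proof. by move=> hi hp pm; rewrite tE ?(@cnt_between d i) //; lia. Qed.

(** Inside a piece p, p + 1 and p + 2 belong to the factor, except at its last position,
where p + 2 is beyond the dot. *)
Lemma piece_items i r : i <= j -> odd i.+1 == e ->
  (if r is Tile _ :: _ then false else true) ->
  items fl (map Tile (piece C d i.+1) ++ r) =
  [seq IT p | p <- iota (dot_pos d i).+1 ((dot_pos d i.+1).-1 - dot_pos d i)] ++ items fl r.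
Proof.
move=> hi oi hr.
have lt := dot_pos_lt hi.
have qm : dot_pos d i.+1 <= m.+1.
  have [h|h] := ltnP i j; last by rewrite dot_pos_over.
  by have [] := dot_pos_bit h; lia.
set p0 := dot_pos d i in lt *; set q := dot_pos d i.+1 in lt qm *.
rewrite /piece [i.+1.-1]/= -/p0 -/q.
set s := take _ _.
have ss : size s = q.-1 - p0 by rewrite /s size_take size_drop size_cells -dC; case: ifP;
  lia.
have sn k : k < size s -> nth CW s k = nth CW (cells C) (p0 + k).
  by rewrite ss => hk; rewrite /s nth_take ?nth_drop //; lia.
rewrite items_tiles //; last first.
  by move=> k hk; rewrite !sn ?addnS //; [apply: cell_left | apply: ltnW].
congr (_ ++ _); rewrite cell_itemsE ss /mkseq -[p0.+1]addn0 iotaDl -map_comp.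
apply/eq_in_map => k; rewrite mem_iota add0n => hk /=.
have -> : clev (nth CW s k) = lv C (p0.+1 + k).
  by rewrite sn ?ss // /lv addSn /= lev_cells (nth_map CW) // size_cells -dC; lia.
rewrite /pos_item (@bit_seg i) ?oi //; try lia.
case: ifP => h; first by rewrite (@bit_seg i) ?oi //; lia.
rewrite (_ : (p0.+1 + k).+2 = q.+1); last lia.
have [h1|h1] := ltnP i j; last by rewrite bit_over // /q dot_pos_over.
have h2 := dot_pos_lt h1.
have [h3 h4] := dot_pos_bit h1.
by rewrite (@bit_seg i.+1) //; [move: oi; case: e => /=; case: (odd i) | lia | lia].
Qed.

Lemma later_dot i : i < j -> odd i.+1 == e -> later t (dot_pos d i.+1) = (i.+1 < j).
Proof.
move=> hi oi; apply/laterP/idP => [[p qp hp]|hj].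
  rewrite ltnNge; apply/negP => jj; have ej : j = i.+1 by apply/eqP; rewrite eqn_leq hi jj.
  have pm : p <= m.+1 by rewrite leqNgt; apply/negP => h; rewrite bit_over in hp.
  move: hp; rewrite (@bit_seg i.+1) ?ej //.
    by move: oi; case: e => /=; case: (odd i).
  by rewrite qp (@dot_pos_over d i.+2) // ej.
have h1 := dot_pos_lt hi; have [h2 h3] := dot_pos_bit hj; have h := dot_pos_lt hj.
exists (dot_pos d i.+2).+1; first by apply: ltnW.
by rewrite (@bit_seg i.+2) //; [rewrite -(eqP oi) /= negbK|lia|lia].
Qed.

(** Descending induction on the dots. The segment between two dots lies in one factor; it
contributes its piece and a mystery square if the factor has further letters, and
nothing if it lies in the other factor. *)
Lemma items_pieces_from i : i <= j.+1 ->
  items fl (join_pieces C d [seq l <- iota i.+1 (j.+1 - i) | odd l == e]) =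
  [seq IT p | p <- iota (dot_pos d i).+1 (m - dot_pos d i) & bit t p && later t p].
Proof.
move=> hi; have [k] := ubnP (j.+1 - i); elim: k i hi => // k IH i hi hk.
have [ij|ij] := ltnP j i.
  have [-> e2] : j.+1 - i = 0 /\ m - m.+1 = 0 by lia.
  by rewrite dot_pos_over // e2.
have lt := dot_pos_lt ij.
have qm : dot_pos d i.+1 <= m.+1.
  have [h|h] := ltnP i j; last by rewrite dot_pos_over.
  by have [] := dot_pos_bit h; lia.
have IHi := IH i.+1 ltac:(lia) ltac:(lia).
have -> : j.+1 - i = (j.+1 - i.+1).+1 by lia.
have -> : m - dot_pos d i =
  ((dot_pos d i.+1).-1 - dot_pos d i) + (m - (dot_pos d i.+1).-1) by lia.
rewrite iotaD filter_cat map_cat.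
have -> : (dot_pos d i).+1 + ((dot_pos d i.+1).-1 - dot_pos d i) = dot_pos d i.+1 by lia.
have -> : iota (dot_pos d i.+1) (m - (dot_pos d i.+1).-1) =
    (if i < j then cons (dot_pos d i.+1) else id) (iota (dot_pos d i.+1).+1 (m - dot_pos
      d i.+1)).
  have [h|h] := ltnP i j; last first.
    have [e1 e2] : m - m.+1.-1 = 0 /\ m - m.+1 = 0 by lia.
    by rewrite dot_pos_over // e1 e2.
  have [h1 h2] := dot_pos_bit h.
  have -> : m - (dot_pos d i.+1).-1 = (m - dot_pos d i.+1).+1 by lia.
  by [].
have [oi|oi] := boolP (odd i.+1 == e); last first.
  rewrite [[seq l <- _ | _]]/= (negbTE oi) IHi.
  have -> : [seq p <- iota (dot_pos d i).+1 ((dot_pos d i.+1).-1 - dot_pos d i)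
      | bit t p && later t p] = [::].
    rewrite -(filter_pred0 (iota (dot_pos d i).+1 ((dot_pos d i.+1).-1 - dot_pos d i))).
    apply: eq_in_filter => p; rewrite mem_iota => hp.
    by rewrite (@bit_seg i) ?(negbTE oi) //; lia.
  case: ifP => h //=; rewrite (@bit_seg i) ?(negbTE oi) // lt leqnn //.
rewrite [[seq l <- iota i.+1 _ | _]]/= oi.
have -> : [seq p <- iota (dot_pos d i).+1 ((dot_pos d i.+1).-1 - dot_pos d i) | bit t p
  && later t p]
   = iota (dot_pos d i).+1 ((dot_pos d i.+1).-1 - dot_pos d i).
  apply/all_filterP/allP => p; rewrite mem_iota => hp.
  rewrite (@bit_seg i) ?oi //=; try lia.
  by apply/laterP; exists p.+1 => //; rewrite (@bit_seg i) ?oi //; lia.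
set R := [seq l <- _ | _] in IHi *.
have hR : (R == [::]) = (j <= i.+1).
  rewrite /R; have [h|h] := leqP j i.+1.
    have [->|->] : j.+1 - i.+1 = 0 \/ j.+1 - i.+1 = 1 by lia.
      by [].
    by move: oi; rewrite /=; case: e; case: (odd i).
  have -> : j.+1 - i.+1 = (j - i.+2).+2 by lia.
  by move: oi; rewrite /=; case: e; case: (odd i).
have jE : join_pieces C d (i.+1 :: R) = map Tile (piece C d i.+1) ++
    (if i.+1 < j then Mystery i.+1 :: join_pieces C d R else [::]).
  by move: hR; rewrite /=; case: R {IHi} => [|u R] /=; case: ltnP; rewrite ?cats0.
rewrite jE piece_items //; last by case: ifP.
congr (_ ++ _); case: ltnP => h.
  have ij' : i < j by lia.
  have [h1 h2] := dot_pos_bit ij'.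
  rewrite ij' /= (@bit_seg i) ?oi ?lt ?leqnn // later_dot // h /= -IHi.
  rewrite flE // /pos_item (@bit_seg i.+1) ?leqnn ?dot_pos_lt //; last lia.
  by move: oi; rewrite /=; case: e; case: (odd i).
have {}IHi : [seq IT p | p <- iota (dot_pos d i.+1).+1 (m - dot_pos d i.+1) & bit t p
  && later t p] = [::].
  by rewrite -IHi; move: hR; rewrite h => /eqP ->.
case: ifP => // h1; rewrite /= later_dot // ltnNge h andbF IHi //.
Qed.

Lemma items_pieces :
  items fl (pieces_of_parity C d e) = [seq IT p | p <- nonlast t].
Proof.
have := items_pieces_from (leq0n _); rewrite subn0 dot_pos0 subn0.
by rewrite /pieces_of_parity /nonlast td => ->.
Qed.
End Pieces.

(** * Levels of a shuffled word, position by position *)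

Definition compl (t : bitseq) : bitseq := map negb t.

Lemma bit_compl t p : 0 < p <= size t -> bit (compl t) p = ~~ bit t p.
Proof. by move=> hp; rewrite /bit (nth_map false) //; lia. Qed.

Lemma bit_out t p : size t < p -> bit t p = false.
Proof. by move=> hp; rewrite /bit nth_default //; lia. Qed.

Lemma bit_mem t p : bit t p -> p <= size t.
Proof. by case: leqP => // /bit_out ->. Qed.

Lemma cnt_bit t p : 0 < p -> cnt t p = bit t p + cnt t p.-1.
Proof. by case: p => // p _; rewrite cntS. Qed.

(** The level of [s] at the position indexed by the element [p] of the set [t]. *)
Definition entry (s : seq nat) (t : bitseq) (p : nat) : nat := nth 0 s (cnt t p).-1.

(** The level at [p] of a permutation cut into a prefix with letter set [t] and levels [F],
and a suffix with levels [G]. If p + 1 or p + 2 lies in the other part, its position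
relative to p is known; otherwise it is read off from the two standardizations. *)
Definition merged_level (t : bitseq) (F G : seq nat) (p : nat) : nat :=
  let f := entry F t p in let g := entry G (compl t) p in
  if bit t p then
    if bit t p.+1 then (if bit t p.+2 then f else if f == 2 then 2 else 0)
    else if bit t p.+2 then (if f == 2 then 1 else 0) else 0
  else if bit t p.+1 then 2
  else if bit t p.+2 then (if g == 2 then 2 else 1) else g.

(** The conditions on the letter set alone. In terms of the dots, which mark the places where
membership in [t] changes: the set is left at black squares or left halves and entered at
the other cells, and the two configurations forbidden in an allowable dotting are absent. *)
Definition admissible (c : nat -> nat) (t : bitseq) : Prop :=
  forall p, 0 < p < size t ->
  [/\ bit t p != bit t p.+1 -> (c p <= 1) = bit t p,
      c p = 1 -> bit t p != bit t p.+1 -> p.+1 < size t /\ bit t p.+1 != bit t p.+2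
    & c p = 0 -> bit t p = bit t p.+1 -> p.+1 < size t -> bit t p.+1 != bit t p.+2 ->
      c p.+1 != 2].

Definition itemA (c : nat -> nat) (t : bitseq) (p : nat) : item :=
  if bit t p.+2 then (if c p == 1 then Exact 2 else Low) else Free.

Definition itemB (p : nat) : item := Free.

Definition fits (c : nat -> nat) my t (F : seq nat) : Prop :=
  forall p, 0 < p < size t -> bit t p -> sat (pos_item c my t p) (entry F t p).

Lemma entry_last t G p : level_word G -> size G = (count id t).-1 -> 0 < p ->
  p.+1 = size t -> bit t p -> bit t p.+1 -> entry G t p != 1.
Proof.
move=> vG sG p0 ps tp tp1; apply/eqP => e1.
have [_ /(_ e1)] := level_word_nth (cnt t p).-1 vG.
rewrite nth_default // sG.
have: cnt t p.+1 = count id t by rewrite /cnt take_oversize // ps.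
by rewrite cntS; move: tp1; rewrite /bit /= => ->; rewrite (cnt_bit _ p0) tp; lia.
Qed.

Lemma entry_le2 t G p : level_word G -> entry G t p <= 2.
Proof. by move=> vG; case: (level_word_nth (cnt t p).-1 vG). Qed.

(** For each pattern of membership of p, p + 1, p + 2 the equation between levels splits into
a condition on [t], one on [F] and one on [G]. Level words enter in three places: in [C] a
level 1 is followed by 2, and neither the last entry of [C] nor that of [G] is 1. *)
Lemma merge_fits C t F G : size t = (slen C).+1 -> level_word F -> level_word G ->
  size G = (count id (compl t)).-1 ->
  (forall p, 0 < p < size t -> lv C p = merged_level t F G p) <->
  [/\ admissible (lv C) t, fits (lv C) (itemA (lv C) t) t F
    & fits (lv C) itemB (compl t) G].
Proof.
move=> st vF vG sG.
have sn : size (compl t) = size t by rewrite size_map.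
have lv_out p : size t <= p -> lv C p = 0.
  by move=> h; rewrite /lv nth_default // size_lev; lia.
split=> [H|[H1 H2 H3] p hp].
  split=> [p hp|p hp tp|p].
  - have e := H p hp; split.
    + by rewrite e /merged_level; case: (bit t p); case: (bit t p.+1);
        case: (bit t p.+2) => //=; case: ifP.
    + rewrite e /merged_level; case: (bit t p) => //=; case: (bit t p.+1) => //=.
      case h : (bit t p.+2) => //= _ _; split=> //.
      by have := bit_mem h.
    + move=> + + hp1; rewrite e (H p.+1) /merged_level; last lia.
      case: (bit t p); case: (bit t p.+1); case: (bit t p.+2) => //=;
        case: (bit t p.+3) => //=; by do ?case: ifP.
  - move: (H p hp); rewrite /merged_level tp /pos_item /itemA.
    move: (entry F t p) => f.
    by case: (bit t p.+1); case: (bit t p.+2) => //= ->; rewrite /= ?eqxx //;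
      case: (f =P 2) => [->|/eqP] //=.
  - rewrite sn => hp; rewrite bit_compl; last lia; move=> /negbTE tp.
    move: (H p hp); rewrite /merged_level tp /pos_item /itemB.
    rewrite (@bit_compl t p.+1); last lia.
    move: (entry G (compl t) p) => f.
    case: (bit t p.+1) => //=; have [p2|p2] := ltnP p.+1 (size t).
      rewrite (@bit_compl t p.+2); last lia.
      by case: (bit t p.+2) => //= ->; rewrite /= ?eqxx //; case: (f =P 2) => [->|/eqP] //=.
    by rewrite !bit_out ?sn //= => ->; case: (f =P 2) => [->|/eqP] //=.
have [A1 A2 A3] := H1 p hp; have c2 := lv_le2 C p.
have f2 := entry_le2 t p vF; have g2 := entry_le2 (compl t) p vG.
have K2 := H2 p hp; have := H3 p; rewrite sn bit_compl; last lia.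
move=> /(_ hp) K3; have p0 : 0 < p by lia.
have v1 := lv_1 p0 (C := C).
have next : p.+1 < size t -> bit t p.+1 != bit t p.+2 -> (lv C p.+1 <= 1) = bit t p.+1.
  by move=> h; case: (H1 p.+1 ltac:(lia)).
move: K2 K3; rewrite /merged_level /pos_item /itemA /itemB.
rewrite (@bit_compl t p.+1); last lia.
have end1 : size t <= p.+1 -> lv C p.+1 = 0 by move/lv_out.
have N2 : bit (compl t) p.+2 = (p.+1 < size t) && ~~ bit t p.+2.
  by case: ltnP => h; [rewrite bit_compl|rewrite bit_out ?sn].
have gl : bit t p = false -> bit t p.+1 = false -> p.+1 =
  size t -> entry G (compl t) p != 1.
  by move=> h1 h2 h3; apply: entry_last => //; rewrite ?sn // bit_compl ?h1 ?h2 //; lia.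
have T2 : size t <= p.+1 -> bit t p.+2 = false by move=> h; rewrite bit_out.
rewrite N2.
case: (bit t p) A1 A2 A3 gl next => /=; case: (bit t p.+1) => /=;
  case t2: (bit t p.+2) T2 => /= T2 A1 A2 A3 gl next.
- by move=> /(_ isT)/eqP ->.
- move=> /(_ isT); case: (lv C p =P 2) => [->|ne] /= => [/eqP -> //|/negbTE -> _].
  have ne1 : lv C p != 1.
    apply/eqP => e1; have := v1 e1;
      have [/next/(_ isT)|/end1 ->//] := ltnP p.+1 (size t); lia.
  by lia.
- move=> /(_ isT); have := A1 isT.
  by case: (lv C p =P 1) => [->|ne1] /= h => [/eqP -> //|/negbTE -> _]; lia.
- move=> _ _; have := A1 isT; case: (lv C p =P 1) => [/A2/(_ isT)[] //|]; lia.
- by have := A1 isT; lia.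
- by have := A1 isT; lia.
- rewrite andbF => _ /(_ isT).
  case: (lv C p =P 2) => [->|ne] /= => [/eqP -> //|/negbTE -> ].
  have pn : p.+1 < size t by rewrite ltnNge; apply/negP => /T2.
  have n0 : lv C p != 0.
    by apply/eqP => /A3/(_ erefl pn isT); have := lv_le2 C p.+1; have := next pn isT; lia.
  by lia.
- rewrite andbT => _ /(_ isT); case: ltnP => [_ /eqP -> //|pn].
  have := gl erefl erefl ltac:(lia).
  have ne1 : lv C p != 1 by apply/eqP => /v1; rewrite end1.
  by case: (lv C p =P 2) => [->|ne] /= ; lia.
Qed.

(** * Templates and position-wise conditions *)

Lemma filter_has_greater (s : seq nat) : sorted ltn s ->
  [seq p <- s | has (fun q => p < q) s] = take (size s).-1 s.
Proof.
elim: s => //= x s IH hs; have hx := order_path_min ltn_trans hs.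
rewrite ltnn /=.
have -> : [seq p <- s | (p < x) || has (fun q => p < q) s] = take (size s).-1 s.
  rewrite -IH ?(path_sorted hs) //; apply: eq_in_filter => p ps.
  by have /= := allP hx p ps; case: ltngtP.
by case: s {IH} hs hx => //= y s _ /andP[-> _].
Qed.

Lemma later_dots t p : later t p = has (fun q => p < q) (dots t).
Proof.
apply/laterP/hasP => [[q pq hq]|[q]].
  by exists q => //; rewrite mem_dots; have := bit_mem hq; rewrite -/(bit t q) hq; lia.
by rewrite mem_dots => /and3P[_ _ hq]; exists q.
Qed.

Lemma nonlast_dots t : nonlast t = take (count id t).-1 (dots t).
Proof.
rewrite -size_dots -filter_has_greater; last first.
  by apply: sorted_filter; [apply: ltn_trans | apply: iota_ltn_sorted].
rewrite {2}/dots -filter_predI /nonlast.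
have eqf : (fun p => bit t p && later t p) =1
    [predI (fun p => has [eta leq p.+1] (dots t)) & (fun p => nth false t p.-1)].
  by move=> p /=; rewrite later_dots andbC.
rewrite -(eq_filter eqf); case st: (size t) => [//|k].
have -> : iota 1 k.+1 = rcons (iota 1 k) k.+1
  by rewrite -[in LHS](addn1 k) iotaD cats1 add1n.
have lk : later t k.+1 = false by rewrite /later drop_oversize ?st.
by rewrite filter_rcons lk andbF.
Qed.

Lemma size_nonlast t : size (nonlast t) = (count id t).-1.
Proof. by rewrite nonlast_dots size_take size_dots; case: ltnP => //; lia. Qed.

Lemma all2_sat_nth (IT : nat -> item) S F : size F = size S ->
  all2 sat (map IT S) F <-> (forall k, k < size S -> sat (IT (nth 0 S k)) (nth 0 F k)).
Proof.
elim: S F => [|p S IH] [|f F] //= [sF]; split=> [/andP[h /(IH _ sF) H] [|k]|H] //.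
  exact: H.
by apply/andP; split; [apply: (H 0) | apply/(IH _ sF) => k; apply: (H k.+1)].
Qed.

(** The last element of the set carries no condition, as [my] is [Free] there; so [fits] may
range over all elements. *)
Lemma all2_sat_fits c my t F : size F = (count id t).-1 ->
  (forall p, bit t p.+1 = false -> bit t p.+2 = false -> my p = Free) ->
  all2 sat (map (pos_item c my t) (nonlast t)) F <-> fits c my t F.
Proof.
move=> sF hmy; rewrite all2_sat_nth ?size_nonlast //.
have nthS k : k < (count id t).-1 -> nth 0 (nonlast t) k = dot_pos t k.+1.
  move=> hk; rewrite nonlast_dots nth_take // /dot_pos /=.
  by apply: set_nth_default; rewrite size_dots; lia.
split=> [H p hp tp|H k hk].
  have [lp|nl] := boolP (later t p); last first.
    have no q : p < q -> bit t q = false.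
      by move=> pq; apply: contraNF nl => tq; apply/laterP; exists q.
    by rewrite /pos_item no // hmy ?no.
  have p0 : 0 < p by case/andP: hp.
  have e := dots_nth p0 tp.
  have kS : (cnt t p).-1 < (count id t).-1.
    have [q pq tq] := laterP _ _ lp.
    have: cnt t q <= count id t
      by rewrite -size_dots -(@cnt_size t (q + size t)) ?leq_cnt //; lia.
    have := @leq_cnt t p q.-1; rewrite (cnt_bit _ p0) (@cnt_bit t q) ?tp ?tq; lia.
  have := H _ kS; rewrite nthS // /entry.
  by rewrite /dot_pos /= (cnt_bit _ p0) tp add1n /= e.
have hk' : k < size (dots t) by rewrite size_dots; lia.
have [h1 h2] := dot_pos_bit hk'.
rewrite nthS //; have := H (dot_pos t k.+1); rewrite /bit h2 /entry.
rewrite cnt_bit ?/bit ?h2 ?cnt_dot_pos ?add1n //=; last by case/andP: h1.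
apply=> //; have hk2 : k.+1 < size (dots t) by rewrite size_dots; lia.
have := dot_pos_lt hk'; have [] := dot_pos_bit hk2; lia.
Qed.

(** * Dottings and sets of letters *)

(** The dots are the places where a set of letters and its complement alternate; [integ]
recovers the set from the dots and the membership of the letter 1. *)
Definition diff (t : bitseq) : bitseq :=
  mkseq (fun i => nth false t i != nth false t i.+1) (size t).-1.

Definition integ (e : bool) (d : bitseq) : bitseq :=
  mkseq (fun i => odd (cnt d i).+1 == e) (size d).+1.

Lemma size_diff t : size (diff t) = (size t).-1. Proof. by rewrite size_mkseq. Qed.

Lemma diff_bit t p : 0 < p < size t -> nth false (diff t) p.-1 = (bit t p != bit t p.+1).
Proof. by move=> hp; rewrite /diff nth_mkseq ?prednK //; lia. Qed.

Lemma bit_integ e d p : 0 < p <= (size d).+1 -> bit (integ e d) p =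
  (odd (cnt d p.-1).+1 == e).
Proof. by move=> hp; rewrite /bit nth_mkseq //; lia. Qed.

Lemma bit_diff t p : 0 < p <= size t -> bit t p = (odd (cnt (diff t) p.-1).+1 == bit t 1).
Proof.
case: p => // p /=; elim: p => [|p IH] hp.
  by rewrite /cnt take0 /=; case: (bit t 1).
have e := @diff_bit t p.+1 ltac:(lia); rewrite /= in e.
rewrite cntS e; move: (IH ltac:(lia)).
move: (cnt _ _) => c /= ->; case: (bit t p.+2) (bit t 1) => -[] /=;
  rewrite ?oddD ?addn0 /=; case: (odd c) => //=.
Qed.

Lemma integ_diff t : 0 < size t -> integ (bit t 1) (diff t) = t.
Proof.
move=> st; apply: (@eq_from_nth _ false); first by rewrite size_mkseq size_diff prednK.
move=> i; rewrite size_mkseq size_diff prednK // => hi.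
by rewrite nth_mkseq ?size_diff ?prednK // [RHS](bit_diff (p := i.+1)).
Qed.

Lemma diff_integ e d : diff (integ e d) = d.
Proof.
apply: (@eq_from_nth _ false); rewrite size_diff size_mkseq //= => i hi.
rewrite (@diff_bit _ i.+1) ?size_mkseq //= !bit_integ /= ?cntS; lia.
Qed.

Lemma clev_cell C p : 0 < p <= slen C -> lv C p = clev (cell_at C p).
Proof.
by move=> hp; rewrite /lv lev_cells (nth_map CW) // size_cells; lia.
Qed.

Lemma black_or_leftE C p : 0 < p <= slen C -> black_or_left C p = (lv C p <= 1).
Proof. by move=> hp; rewrite clev_cell // /black_or_left; case: cell_at. Qed.

Section Admissible.
Variables (C : sash) (t : bitseq).
Hypothesis tC : size t = (slen C).+1.

Local Notation d := (diff t).
Local Notation c := (lv C).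

Let sd : size d = slen C. Proof. by rewrite size_diff tC. Qed.

Lemma dottedE p : 0 < p <= slen C -> dotted d p = (bit t p != bit t p.+1).
Proof. by move=> hp; rewrite /dotted mem_dots diff_bit ?tC ?sd; lia. Qed.

Lemma dotted_over p : slen C < p -> dotted d p = false.
Proof. by move=> hp; rewrite /dotted mem_dots sd; lia. Qed.

(** The entries alternate, hence are determined by the first one. *)
Lemma sorted_alternate (e0 : bool) s : sorted (fun e f : bool => e != f) s ->
  forall i, i < size s -> nth e0 s i = (odd i.+1 == nth e0 s 0).
Proof.
move=> /(sortedP e0) h; elim=> [|i IH] hi; first by case: (nth _ _ _).
by have := h i hi; rewrite IH 1?ltnW //=; case: (nth _ _ i.+1); case: (nth _ _ 0);
  case: (odd i).
Qed.

Lemma no_dots : dots d = [::] -> forall p, 0 < p <= size t -> bit t p = bit t 1.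
Proof.
move=> h p hp; rewrite bit_diff //.
have -> : cnt d p.-1 = 0 by have := leq_cnt d (leq_addr (size d) p.-1);
  rewrite (@cnt_size d (p.-1 + _)) ?h /= ?leq_addl //; lia.
by case: (bit t 1).
Qed.

Lemma nonconstant_dots : (dots d != [::]) = (0 < count id t < size t).
Proof.
apply/idP/idP => [|h]; last first.
  apply/eqP => h0; have hc := no_dots h0.
  have ht : t = nseq (size t) (bit t 1).
    apply: (@eq_from_nth _ false) => [|i hi]; first by rewrite size_nseq.
    by rewrite nth_nseq hi -(hc i.+1).
  by move: h; rewrite ht count_nseq size_nseq; case: (bit t 1); lia.
case e : (dots d) => [//|p s] _; have: p \in dots d by rewrite e mem_head.
rewrite mem_dots => /and3P[p0 ps]; rewrite diff_bit; last by rewrite size_diff in ps; lia.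
have ts : 0 < p < size t by rewrite size_diff in ps; lia.
move=> hp; rewrite -has_count ltn_neqAle count_size andbT -all_count.
have tm b q : 0 < q <= size t -> bit t q = b -> b \in t.
  by case: q => // q hq <-; apply: mem_nth.
have [tT tF] : true \in t /\ false \in t.
  case e1: (bit t p) hp => /= hp; case e2: (bit t p.+1) hp => // _.
    by split; [apply: (tm _ p)|apply: (tm _ p.+1)] => //; lia.
  by split; [apply: (tm _ p.+1)|apply: (tm _ p)] => //; lia.
apply/andP; split; first by apply/hasP; exists true.
by apply/allPn; exists false.
Qed.

Lemma bit_at_dot i : i < size (dots d) -> bit t (dot_pos d i.+1) = (odd i.+1 == bit t 1).
Proof.
move=> hi; have [h1 h2] := dot_pos_bit hi.
by rewrite bit_diff ?cnt_dot_pos //; rewrite size_diff in h1; lia.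
Qed.

(** A set of letters comes from an allowable dotting, the type of the first dot telling
whether 1 belongs to the set, iff it is neither empty nor full and is admissible. *)
Lemma allowableP :
  reflect ((0 < count id t < size t) /\ admissible c t)
    (allowable C d && (black_or_left C (dot_pos d 1) == bit t 1)).
Proof.
have dn i : i < size (dots d) -> nth 0 (dots d) i = dot_pos d i.+1.
  by move=> hi; rewrite /dot_pos /=; apply: set_nth_default.
rewrite -nonconstant_dots /allowable.
apply: (iffP idP) => [/andP[/and3P[nd so /allP al] /eqP e1]|[nd al]].
  split=> // p hp; have hp' : 0 < p <= slen C by lia.
  have := al p; rewrite mem_iota sd => /(_ ltac:(lia)) /andP[al1 al2].
  rewrite !(dottedE hp') in al1 al2; split.
  - move=> tp; have pd : nth false d p.-1 by rewrite diff_bit.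
    have p0 : 0 < p by case/andP: hp.
    have := dots_nth p0 pd; set i := cnt _ _ => ei.
    have hi : i < size (dots d).
      by rewrite ltnNge; apply/negP => hi; move: hp';
        rewrite -ei nth_default // sd ltnn andbF.
    have := sorted_alternate true so (i := i); rewrite size_map => /(_ hi).
    rewrite !(nth_map 0) ?dn // ?(leq_ltn_trans (leq0n i)) //.
    by rewrite e1 -bit_at_dot // /dot_pos /= ei -black_or_leftE.
  - rewrite clev_cell // => c1 tp; move: al1; rewrite tp.
    have -> : cell_at C p == CL by move: c1; case: (cell_at C p).
    rewrite /= negbK => h; have [pm|pm] := ltnP (slen C) p.+1;
      first by rewrite dotted_over in h.
    by rewrite -dottedE // tC; split=> //; lia.
  - rewrite clev_cell // => c0 tp pm; move: al2; rewrite tp eqxx /=.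
    rewrite tC in pm; rewrite -dottedE; last lia.
    have -> /= : cell_at C p == CB by move: c0; case: (cell_at C p).
    move=> h1 h2; move: h1; rewrite h2 andbT clev_cell; last lia.
    have: cell_at C p.+1 != CR.
      apply/eqP => h; move: c0; rewrite {1}/cell_at.
      have p0 : 0 < p by lia.
      by move: h; rewrite /cell_at -{1}(prednK p0) => /cell_right ->.
    by case: (cell_at C p.+1).
have bd i : i < size (dots d) -> black_or_left C (dot_pos d i.+1) = (odd i.+1 == bit t 1).
  move=> hi; rewrite -bit_at_dot //; have [h1 h2] := dot_pos_bit hi.
  rewrite sd in h1; rewrite black_or_leftE //.
  have hp : 0 < dot_pos d i.+1 < size t by rewrite tC; lia.
  by have [-> //] := al _ hp; rewrite -diff_bit.
have d0 : 0 < size (dots d) by case: (dots d) nd.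
rewrite nd bd //=; apply/andP; split; last by case: (bit t 1).
apply/andP; split.
  apply/(sortedP true) => i; rewrite size_map => hi.
  rewrite !(nth_map 0) ?dn ?bd //; try by apply: ltnW.
  by case: (bit t 1) => /=; case: (odd i).
apply/allP => p; rewrite mem_iota sd => hp.
have hp' : 0 < p <= slen C by lia.
have [|A1 A2 A3] := al p; first by rewrite tC; lia.
rewrite !(dottedE hp'); apply/andP; split.
  apply/and3P => -[/eqP h1 h2]; have [||h3 h4] := A2 => //;
    first by rewrite clev_cell // h1.
  by rewrite dottedE ?h4 //; lia.
apply/and4P => -[/eqP h1 /negbNE/eqP h2 /eqP h3].
have [pm|pm] := ltnP (slen C) p.+1; first by rewrite dotted_over.
rewrite dottedE; last lia.
move=> h4; have := A3; rewrite clev_cell // h1 => /(_ erefl h2 ltac:(lia) h4).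
by rewrite clev_cell ?h3 //; lia.
Qed.
End Admissible.

(** * The intervals of a dotting *)

Lemma sash_interval D E M F : lev D = map low M -> lev E = high M -> all bounded M ->
  [&& F \in Sigma (slen D), sash_le D F & sash_le F E] =
  (F \in Sigma (size M)) && all2 sat M (lev F).
Proof.
move=> hD hE bM; have sD : slen D = size M by rewrite -size_lev hD size_map.
have sE : slen E = size M by rewrite -size_lev hE size_high.
rewrite sD mem_Sigma; case: eqP => //= sF.
by rewrite !sash_leE ?sD ?sF // hD hE template_interval ?lev_level_word // size_lev.
Qed.

Section Intervals.
Variables (C : sash) (t : bitseq).
Hypothesis tC : size t = (slen C).+1.
Hypothesis ta : admissible (lv C) t.
Hypothesis tn : 0 < count id t < size t.

Local Notation d := (diff t).
Local Notation c := (lv C).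

Let sd : size d = slen C. Proof. by rewrite size_diff tC. Qed.

Let e1 : black_or_left C (dot_pos d 1) = bit t 1.
Proof. by have /(allowableP tC)/andP[_ /eqP] := conj tn ta. Qed.

(** When exactly one letter q + 1 separates q from the next letter q + 2, admissibility makes
q + 1 a white square or right half, and the cell at q tells the two cases apart. *)
Lemma flagA_at i : odd i == bit t 1 -> 0 < i < size (dots d) ->
  flagA C d i = itemA c t (dot_pos d i).
Proof.
case: i => // i oi /= hi; have hi' : i < size (dots d) by apply: ltnW.
have [h1 h2] := dot_pos_bit hi'; have [h3 h4] := dot_pos_bit hi.
have lt := dot_pos_lt hi'; have bq := bit_at_dot tC hi'.
set q := dot_pos d i.+1 in h1 h2 lt bq *; rewrite sd in h1 h3.
have [|A1 _ _] := ta (p := q); first by rewrite tC; lia.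
have [|B1 _ _] := ta (p := q.+1); first by rewrite tC; lia.
have qd : bit t q != bit t q.+1 by rewrite -diff_bit // tC; lia.
have tq : bit t q by rewrite bq.
have tq1 : bit t q.+1 = false by move: qd; rewrite tq; case: (bit t q.+1).
have := A1 qd; rewrite tq clev_cell // => cq.
have nx : (dot_pos d i.+2 == q.+1) = bit t q.+2.
  rewrite -[bit t q.+2](_ : (bit t q.+1 != bit t q.+2) = _); last by rewrite tq1;
    case: (bit t q.+2).
  rewrite -(@diff_bit t q.+1) ?tC; last lia.
  apply/eqP/idP => [<- //|hd].
  have := @dots_nth d q.+1 isT hd; rewrite [q.+1.-1]/=.
  have -> : cnt d q = i.+1.
    by rewrite cnt_bit ?cnt_dot_pos // ?[bit _ _]h2 //; case/andP: h1.
  by rewrite /dot_pos.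
rewrite /flagA /itemA /same_rectangle /black_then_white -/q nx.
case t2: (bit t q.+2) nx B1 => nx; last by rewrite andbF /= andbF.
rewrite tq1 clev_cell; last lia.
move=> /(_ isT) cq1; rewrite !andbT /= clev_cell //.
have nR : cell_at C q = CB -> cell_at C q.+1 != CR.
  move=> qB; apply/eqP => h; move: qB; rewrite {1}/cell_at.
  have q0 : 0 < q by case/andP: h1.
  by move: h; rewrite /cell_at -{1}(prednK q0) => /cell_right ->.
rewrite (eqP nx).
move: cq cq1 nR; case: (cell_at C q) => //= _.
by case: (cell_at C q.+1) => //= _ /(_ erefl).
Qed.

Lemma items_mA : items (flagA C d) (mA C d) =
  [seq pos_item c (itemA c t) t p | p <- nonlast t].
Proof.
rewrite /mA e1; apply: items_pieces; [exact: sd|by rewrite sd| |exact: flagA_at].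
by move=> p; rewrite sd -tC; apply: bit_diff.
Qed.

Lemma items_mB : items flagB (mB C d) =
  [seq pos_item c itemB (compl t) p | p <- nonlast (compl t)].
Proof.
rewrite /mB e1; apply: items_pieces; rewrite ?sd ?size_map // => p hp.
rewrite bit_compl ?tC // (bit_diff (t := t)) ?tC //.
by case: (bit t 1) => /=; case: odd.
Qed.

Lemma bounded_pos_item my s : (forall p, bounded (my p)) ->
  all bounded [seq pos_item c my s p | p <- nonlast s].
Proof.
move=> h; rewrite all_map; apply/allP => p _; rewrite /= /pos_item.
by case: ifP => // _; case: ifP => // _ /=; [apply: lv_le2 | case: ifP].
Qed.

Lemma intervalA F :
  [&& F \in Sigma (slen (lowA C d)), sash_le (lowA C d) F & sash_le F (highA C d)] <->
  F \in Sigma (count id t).-1 /\ fits c (itemA c t) t (lev F).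
Proof.
rewrite (sash_interval F (lev_lowA _ _) (lev_highA _ _)) items_mA; last first.
  by apply: bounded_pos_item => p; rewrite /itemA; case: ifP => // _; case: ifP.
rewrite size_map size_nonlast mem_Sigma; case: eqP => sF; last by split=> // -[].
rewrite andTb all2_sat_fits ?size_lev //; first by split=> // -[].
by move=> p h1 h2; rewrite /itemA h2.
Qed.

Lemma intervalB G :
  [&& G \in Sigma (slen (lowB C d)), sash_le (lowB C d) G & sash_le G (highB C d)] <->
  G \in Sigma (count id (compl t)).-1 /\ fits c itemB (compl t) (lev G).
Proof.
rewrite (sash_interval G (lev_lowB _ _) (lev_highB _ _)) items_mB;
  last exact: bounded_pos_item.
rewrite size_map size_nonlast mem_Sigma; case: eqP => sG; last by split=> // -[].
by rewrite andTb all2_sat_fits ?size_lev //; split=> // -[].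
Qed.

End Intervals.

(** * Standardization *)

Definition rank (w : seq nat) (v : nat) : nat := count (fun u => u <= v) w.

Lemma stE w : st w = map (rank w) w. Proof. by []. Qed.

Lemma size_st w : size (st w) = size w. Proof. by rewrite size_map. Qed.

Lemma rank_perm w w' : perm_eq w w' -> rank w =1 rank w'.
Proof. by move=> /permP h v; apply: h. Qed.

Lemma leq_rank w : {homo rank w : a b / a <= b}.
Proof. by move=> a b ab; apply: sub_count => u /= ua; apply: leq_trans ab. Qed.

Lemma rankS w v : uniq w -> rank w v.+1 = (v.+1 \in w) + rank w v.
Proof.
move=> uw; rewrite -count_uniq_mem // /rank -count_predUI.
rewrite (@eq_count _ (predI _ _) pred0) ?count_pred0 ?addn0; last by move=> u /=; lia.
by apply: eq_count => u /=; lia.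
Qed.

Lemma rank_lt w a b : uniq w -> a < b -> b \in w -> rank w a < rank w b.
Proof.
by case: b => // b uw ab bw; rewrite rankS // bw add1n ltnS leq_rank.
Qed.

Lemma rank_inj w : uniq w -> {in w &, injective (rank w)}.
Proof.
move=> uw a b aw bw e; have [ab|ab|//] := ltngtP a b.
  by have := rank_lt uw ab bw; rewrite e ltnn.
by have := rank_lt uw ab aw; rewrite e ltnn.
Qed.

Lemma st_is_perm w : uniq w -> is_perm (st w).
Proof.
move=> uw; have us : uniq (st w) by rewrite map_inj_in_uniq //; apply: rank_inj.
have sub : {subset st w <= iota 1 (size (st w))}.
  move=> _ /mapP[v vw ->]; rewrite mem_iota size_st add1n ltnS count_size andbT.
  by rewrite -has_count; apply/hasP; exists v.
have [|_ mem] := uniq_min_size us sub; first by rewrite size_iota.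
by apply: uniq_perm => //; apply: iota_uniq.
Qed.

Lemma left_of_st w a b : uniq w -> a \in w -> b \in w ->
  left_of (st w) (rank w a) (rank w b) = left_of w a b.
Proof.
move=> uw; have ind c : c \in w -> index (rank w c) (st w) = index c w.
  move=> cw; have e := nth_index_map 0 (rank_inj uw) cw.
  rewrite -{2}e index_uniq // -(size_st w) index_mem; exact: map_f.
by move=> aw bw; rewrite /left_of !ind.
Qed.

Lemma count_leq_iota v n : count (fun u => u <= v) (iota 1 n) = minn v n.
Proof.
elim: n => [|n IH]; first by rewrite minn0.
by rewrite -[n.+1]addn1 iotaD count_cat IH /=; lia.
Qed.

Lemma st_id y : is_perm y -> st y = y.
Proof.
move=> py; rewrite stE -[RHS]map_id; apply/eq_in_map => v.
by rewrite mem_is_perm // (rank_perm py) /rank count_leq_iota; lia.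
Qed.

(** * Words with prescribed sets of letters *)

Definition bits (n : nat) (w : seq nat) : bitseq := [seq p \in w | p <- iota 1 n].

Lemma size_bits n w : size (bits n w) = n. Proof. by rewrite size_map size_iota. Qed.

Lemma bit_bits n w p : 0 < p <= n -> bit (bits n w) p = (p \in w).
Proof.
by move=> hp; rewrite /bit (nth_map 0) ?size_iota ?nth_iota ?add1n ?prednK //; lia.
Qed.

Lemma rank_dots t p : rank (dots t) p = cnt t p.
Proof.
rewrite /rank /cnt -{1}(cat_take_drop p t) dots_cat count_cat -[RHS]addn0.
congr (_ + _).
  rewrite -size_dots; apply/eqP; rewrite -all_count; apply/allP => q.
  by rewrite mem_dots => /and3P[_ h _]; rewrite (leq_trans h) // size_take_min geq_minl.
apply/eqP; rewrite -leqn0 leqNgt -has_count; apply/hasPn => _ /mapP[q + ->].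
rewrite mem_dots size_drop => /and3P[q0 qs _].
have pt : p < size t by rewrite -subn_gt0 (leq_trans q0).
by rewrite -ltnNge size_take pt -addn1 leq_add2l.
Qed.

Lemma perm_dots_bits n w : uniq w -> {in w, forall p, 0 < p <= n} ->
  perm_eq w (dots (bits n w)).
Proof.
move=> uw hw; apply: uniq_perm => // [|p]; first exact: dots_uniq.
rewrite mem_dots size_bits; have [hp|hp] := boolP (0 < p <= n).
  by have [p0 pn] := andP hp; rewrite p0 pn -/(bit _ p) bit_bits.
rewrite andbA (negbTE hp); apply: contraNF hp; exact: hw.
Qed.

Lemma rank_bits n w p : uniq w -> {in w, forall p, 0 < p <= n} ->
  rank w p = cnt (bits n w) p.
Proof. by move=> uw hw; rewrite (rank_perm (perm_dots_bits uw hw)) rank_dots. Qed.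

Lemma plevel_over x r : is_perm x -> size x <= r -> plevel x r = 0.
Proof.
move=> px hr; have h a : r < a -> left_of x a r = false.
  by move=> ra; apply/negP => /left_of_mem; rewrite mem_is_perm //; lia.
by rewrite /plevel !h.
Qed.

Lemma levels_entry x t p : is_perm x -> size x = count id t -> bit t p -> 0 < p ->
  entry (levels x) t p = plevel x (cnt t p).
Proof.
move=> px sx tp p0; rewrite /entry.
have c0 : 0 < cnt t p by rewrite cnt_bit // tp.
have [h|h] := ltnP (cnt t p) (size x); first by rewrite nth_levels ?prednK //; lia.
by rewrite plevel_over // nth_default // size_map size_iota; lia.
Qed.

Section LocalLevels.
Variable w : seq nat.
Hypothesis uw : uniq w.

Lemma plevel_st_next p : p \in w -> p.+1 \in w -> (plevel (st w) (rank w p) == 2) =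
  left_of w p.+1 p.
Proof. by move=> h0 h1; rewrite plevel_eq2 -(left_of_st uw h1 h0) rankS // h1. Qed.

Lemma plevel_st_skip p : p \in w -> p.+1 \notin w -> p.+2 \in w ->
  (plevel (st w) (rank w p) == 2) = left_of w p.+2 p.
Proof.
by move=> h0 h1 h2; rewrite plevel_eq2 -(left_of_st uw h2 h0) !rankS // h2 (negbTE h1).
Qed.

Lemma plevel_st p : p \in w -> p.+1 \in w -> p.+2 \in w -> plevel (st w) (rank w p) =
  plevel w p.
Proof. by move=> h0 h1 h2;
  rewrite /plevel -(left_of_st uw h1 h0) -(left_of_st uw h2 h0) !rankS // h2 h1. Qed.

Lemma plevel_st_last p : p \in w -> p.+1 \in w -> rank w p.+1 = size w ->
  plevel (st w) (rank w p) = if left_of w p.+1 p then 2 else 0.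
Proof.
move=> h0 h1 hs; rewrite -plevel_st_next //; have := plevel_le2 (st w) (rank w p).
suff: plevel (st w) (rank w p) <> 1 by case: eqP => //; lia.
move/plevel_1 => h; have := plevel_over (st_is_perm uw) (_ : size (st w) <= (rank w p).+1).
by rewrite h size_st -hs rankS // h1 add1n leqnn => /(_ isT).
Qed.
End LocalLevels.

Section Merge.
Variables (y : seq nat) (k : nat).
Hypothesis py : is_perm y.
Hypothesis ky : k <= size y.

Local Notation w1 := (take k y).
Local Notation w2 := (drop k y).
Local Notation t := (bits (size y) w1).

Let uy : uniq y. Proof. exact: is_perm_uniq. Qed.
Let u1 : uniq w1. Proof. exact: take_uniq. Qed.
Let u2 : uniq w2. Proof. exact: drop_uniq. Qed.

Let r1 : {in w1, forall p, 0 < p <= size y}.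
Proof. by move=> p /mem_take; rewrite mem_is_perm. Qed.

Let r2 : {in w2, forall p, 0 < p <= size y}.
Proof. by move=> p /mem_drop; rewrite mem_is_perm. Qed.

Lemma mem_drop_take p : p \in y -> (p \in w2) = (p \notin w1).
Proof.
move: uy; rewrite -{1 2}(cat_take_drop k y) cat_uniq mem_cat => /and3P[_ /hasPn h _].
case/orP=> hp; last by rewrite hp (h _ hp).
by rewrite hp /=; apply/negP => /h /=; rewrite hp.
Qed.

Lemma compl_bits : compl t = bits (size y) w2.
Proof.
rewrite /compl /bits -map_comp; apply/eq_in_map => p; rewrite mem_iota => hp /=.
by rewrite mem_drop_take // mem_is_perm //; lia.
Qed.

Lemma left_of_take a b : a \in w1 -> left_of y a b = left_of w1 a b.
Proof.
move=> ha; rewrite -{1}(cat_take_drop k y) /left_of !index_cat ha.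
case: ifP => // nb; rewrite [index b w1]memNindex ?nb // index_mem ha ltn_addr //.
by rewrite index_mem.
Qed.

Lemma left_of_take_out a b : a \in w1 -> b \notin w1 -> left_of y a b.
Proof. by move=> ha hb; rewrite left_of_take // /left_of (memNindex hb) index_mem. Qed.

Lemma left_of_out_take a b : a \notin w1 -> b \in w1 -> left_of y a b = false.
Proof.
move=> ha hb; rewrite -(cat_take_drop k y) /left_of !index_cat hb (negbTE ha).
by apply/leq_gtF/ltnW/ltn_addr; rewrite index_mem.
Qed.

Lemma left_of_drop a b : a \notin w1 -> b \notin w1 -> left_of y a b = left_of w2 a b.
Proof.
move=> ha hb; rewrite -{1}(cat_take_drop k y) /left_of !index_cat.
by rewrite (negbTE ha) (negbTE hb) ltn_add2l.
Qed.

Lemma count_bits w : uniq w -> {in w, forall p, 0 < p <= size y} ->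
  count id (bits (size y) w) = size w.
Proof. by move=> uw hw; rewrite -size_dots (perm_size (perm_dots_bits uw hw)). Qed.

(** Every letter of the prefix precedes all letters outside it, and relative positions
within either part are those of its standardization. *)
Lemma plevel_merge p : 0 < p < size y ->
  plevel y p = merged_level t (levels (st w1)) (levels (st w2)) p.
Proof.
move=> hp; have p0 : 0 < p by case/andP: hp.
have e1 : bit t p -> entry (levels (st w1)) t p = plevel (st w1) (rank w1 p).
  move=> tp; rewrite levels_entry ?st_is_perm ?size_st ?count_bits //.
  by rewrite -rank_bits.
have e2 : bit t p = false -> entry (levels (st w2)) (compl t) p =
  plevel (st w2) (rank w2 p).
  move=> tp; rewrite compl_bits levels_entry ?st_is_perm ?size_st ?count_bits //.
    by rewrite -rank_bits.
  by rewrite -compl_bits bit_compl ?tp // size_bits; lia.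
have t0 : bit t p = (p \in w1) by rewrite bit_bits //; lia.
have t1 : bit t p.+1 = (p.+1 \in w1) by rewrite bit_bits //; lia.
have t2 : bit t p.+2 = (p.+2 \in w1).
  have [h|h] := ltnP p.+1 (size y); first by rewrite bit_bits.
  by rewrite bit_out ?size_bits //; apply/esym/negP => /r1; lia.
have ps : p < size y by case/andP: hp.
have d0 : (p \in w2) = (p \notin w1).
  by apply: mem_drop_take; rewrite mem_is_perm // p0 ltnW.
have d1 : (p.+1 \in w2) = (p.+1 \notin w1).
  by apply: mem_drop_take; rewrite mem_is_perm.
rewrite /merged_level t0 t1 t2 in e1 e2 *.
case i0: (p \in w1) in d0 e1 e2 *; case i1: (p.+1 \in w1) in d1 *;
  case i2: (p.+2 \in w1).
- rewrite e1 // plevel_st // /plevel -!left_of_take ?i1 ?i2 //.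
- rewrite e1 // plevel_st_next // /plevel left_of_take // [left_of y p.+2
    p]left_of_out_take ?i2 //.
- rewrite e1 // plevel_st_skip ?i1 // /plevel left_of_out_take ?i1 // left_of_take ?i2 //.
- by rewrite /plevel !left_of_out_take ?i1 ?i2.
- by rewrite /plevel left_of_take_out ?i0 ?i1.
- by rewrite /plevel left_of_take_out ?i0 ?i1.
- rewrite e2 // plevel_st_next // /plevel left_of_drop ?i1 ?i0 // left_of_take_out ?i2
    ?i0 //.
- rewrite e2 //; have [h|h] := ltnP p.+1 (size y).
    have d2 : p.+2 \in w2 by rewrite mem_drop_take ?i2 // mem_is_perm //; lia.
    by rewrite plevel_st // /plevel !left_of_drop ?i0 ?i1 ?i2.
  rewrite plevel_st_last //; last first.
    by apply/eqP; rewrite -all_count; apply/allP => q /r2/andP[_ qy]; apply: leq_trans qy h.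
  rewrite /plevel left_of_drop ?i0 ?i1 //; case: ifP => // _.
  by rewrite ifF //; apply/negP => /left_of_mem; rewrite mem_is_perm //= ltnNge h.
Qed.
End Merge.

Lemma map_dot_pos t : [seq dot_pos t i | i <- iota 1 (count id t)] = dots t.
Proof.
apply: (@eq_from_nth _ 0); first by rewrite size_map size_iota size_dots.
move=> i; rewrite size_map size_iota => hi.
rewrite (nth_map 0) ?size_iota // nth_iota // add1n /dot_pos /=.
by apply: set_nth_default; rewrite size_dots.
Qed.

Lemma st_dot_pos t u : is_perm u -> size u = count id t ->
  perm_eq (map (dot_pos t) u) (dots t) /\ st (map (dot_pos t) u) = u.
Proof.
move=> pu su; have pw : perm_eq (map (dot_pos t) u) (dots t).
  by rewrite -map_dot_pos -su; apply: perm_map.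
split=> //; rewrite stE -map_comp -[RHS]map_id; apply/eq_in_map => -[|i].
  by rewrite mem_is_perm.
rewrite mem_is_perm // su -size_dots => hi /=.
rewrite (rank_perm pw) rank_dots; have [h1 h2] := dot_pos_bit hi.
by rewrite cnt_bit ?cnt_dot_pos // /bit ?h2 //; case/andP: h1.
Qed.

(** Relabelling the standardized words by the given sets of letters inverts standardization. *)
Lemma word_exists t u v : is_perm u -> is_perm v ->
  size u = count id t -> size v = count id (compl t) ->
  exists y, [/\ is_perm y, size y = size t, st (take (count id t) y) = u,
    st (drop (count id t) y) = v & bits (size t) (take (count id t) y) = t].
Proof.
move=> pu pv su sv; have [p1 e1] := st_dot_pos pu su; have [p2 e2] := st_dot_pos pv sv.
have sw : size (map (dot_pos t) u) = count id t by rewrite size_map.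
exists (map (dot_pos t) u ++ map (dot_pos (compl t)) v).
have sy : size (map (dot_pos t) u ++ map (dot_pos (compl t)) v) = size t.
  by rewrite size_cat !size_map su sv count_map -(count_predC id).
rewrite take_size_cat // drop_size_cat //; split=> //.
  rewrite /is_perm sy; apply: perm_trans (perm_cat p1 p2) _.
  rewrite /dots size_map (@eq_in_filter _ (fun p =>
    nth false (compl t) p.-1) (predC (fun p => nth false t p.-1))).
    by rewrite perm_filterC.
  by move=> p; rewrite mem_iota => hp /=; rewrite -/(bit (compl t) p) bit_compl //; lia.
apply: (@eq_from_nth _ false); first by rewrite size_bits.
move=> i; rewrite size_bits => hi; rewrite -[LHS]/(bit _ i.+1) bit_bits //.
by rewrite (perm_mem p1) mem_dots hi.
Qed.

(** * Cuts of permutations and dottings *)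

Definition letter_bits n (w : seq nat) : n.-tuple bool :=
  Tuple (introT eqP (size_bits n w)).

(** The terms of the coproduct with both tensor factors nontrivial. *)
Definition cuts (C : sash) : seq (seq nat * nat) :=
  [seq (y, k) | y <- [seq y <- permutations (iota 1 (slen C).+1) | sigma y == Some C],
                k <- [seq k <- iota 1 (slen C) | pell (st (take k y))
                  && pell (st (drop k y))]].

Definition dotted_pairs (C : sash) (d : bitseq) : seq (sash * sash) :=
  [seq (F, G)
  | F <- [seq F <- Sigma (slen (lowA C d)) | sash_le (lowA C d) F && sash_le F (highA C d)],
    G <- [seq G <- Sigma (slen (lowB C d)) | sash_le (lowB C d) G
      && sash_le G (highB C d)]].

Definition parts (yk : seq nat * nat) : sash * sash :=
  (sash_of (st (take yk.2 yk.1)), sash_of (st (drop yk.2 yk.1))).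

Lemma mem_cuts C y k : ((y, k) \in cuts C) =
  [&& is_perm y, size y == (slen C).+1, sigma y == Some C, 0 < k <= slen C,
      pell (st (take k y)) & pell (st (drop k y))].
Proof.
apply/allpairsPdep/idP => [[y' [k' []]]|].
  rewrite !mem_filter mem_permutations mem_iota => /andP[hs hy] /andP[hp hk] [-> ->].
  have sy : size y' = (slen C).+1 by rewrite (perm_size hy) size_iota.
  by rewrite hs hp /is_perm sy hy eqxx !andbT /=; lia.
case/and5P=> py /eqP sy hs hk hp; exists y, k;
  rewrite !mem_filter mem_permutations -sy hs hp.
by rewrite -/(is_perm y) py mem_iota; split=> //=; lia.
Qed.

Lemma cuts_uniq C : uniq (cuts C).
Proof.
apply: allpairs_uniq_dep => [|y _|]; rewrite ?filter_uniq ?permutations_uniq ?iota_uniq //.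
by move=> [y k] [y' k'] _ _ /= [-> ->].
Qed.

Lemma dotted_pairs_uniq C d : uniq (dotted_pairs C d).
Proof.
apply: allpairs_uniq; rewrite ?filter_uniq ?Sigma_uniq //.
by move=> [F G] [F' G'] _ _ /= [-> ->].
Qed.

Lemma mem_pairs (T U : eqType) (s1 : seq T) (s2 : seq U) a b :
  ((a, b) \in [seq (x, y) | x <- s1, y <- s2]) = (a \in s1) && (b \in s2).
Proof.
apply/allpairsP/andP => [[[x y] /= [xs ys [-> ->]]] //|[xs ys]].
by exists (a, b).
Qed.

Lemma mem_dotted_pairs C d F G : ((F, G) \in dotted_pairs C d) =
  [&& F \in Sigma (slen (lowA C d)), sash_le (lowA C d) F & sash_le F (highA C d)] &&
  [&& G \in Sigma (slen (lowB C d)), sash_le (lowB C d) G & sash_le G (highB C d)].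
Proof.
by rewrite mem_pairs !mem_filter andbC [_ && (F \in _)]andbC [_ && (G \in _)]andbC andbC.
Qed.

Lemma st_inj w w' : uniq w -> perm_eq w w' -> st w = st w' -> w = w'.
Proof.
move=> uw pw e; have sw := perm_size pw.
apply: (@eq_from_nth _ 0) => // i hi.
have: nth 0 (st w) i = nth 0 (st w') i by rewrite e.
rewrite !stE !(nth_map 0) -?sw // -(rank_perm pw); apply: rank_inj => //.
  exact: mem_nth.
by rewrite (perm_mem pw) mem_nth // -sw.
Qed.

Section Fibre.
Variables (C : sash) (t : (slen C).+1.-tuple bool).

Let cuts_t := [seq yk <- cuts C | letter_bits (slen C).+1 (take yk.2 yk.1) == t].

Lemma cuts_tP y k : (y, k) \in cuts_t ->
  [/\ [/\ is_perm y, size y = (slen C).+1, sigma y = Some C & 0 < k <= slen C],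
      bits (size y) (take k y) = t,
      pell (st (take k y)) & pell (st (drop k y))].
Proof.
rewrite mem_filter mem_cuts => /andP[/eqP e /and5P[py /eqP sy /eqP hs hk /andP[p1 p2]]].
by split=> //; rewrite sy -e.
Qed.

Lemma cut_letters y k : (y, k) \in cuts_t ->
  perm_eq (take k y) (dots t) /\ perm_eq (drop k y) (dots (compl t)).
Proof.
case/cuts_tP=> -[py sy _ hk] <- _ _; have uy := is_perm_uniq py; split.
  apply: perm_dots_bits; first exact: take_uniq.
  by move=> p /mem_take; rewrite mem_is_perm.
rewrite compl_bits //; apply: perm_dots_bits; first exact: drop_uniq.
by move=> p /mem_drop; rewrite mem_is_perm.
Qed.

Lemma size_cut y k : (y, k) \in cuts_t -> k = count id t /\ size y - k = count id (compl t).
Proof.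
move=> h; have [h1 h2] := cut_letters h; have [[_ sy _ hk] _ _ _] := cuts_tP h.
have := perm_size h1; have := perm_size h2; rewrite !size_dots size_drop size_takel;
  last lia.
by move=> <- <-.
Qed.

Lemma parts_inj : {in cuts_t &, injective parts}.
Proof.
move=> [y k] [y' k'] h h'.
have [[py sy _ hk] _ p1 p2] := cuts_tP h; have [[py' sy' _ hk'] _ p1' p2'] := cuts_tP h'.
have [l1 l2] := cut_letters h; have [l1' l2'] := cut_letters h'.
have [k1 _] := size_cut h; have [k1' _] := size_cut h'.
have ek : k = k' by rewrite k1.
rewrite -{}ek {k1' hk'} in p1' p2' l1' l2' *.
move=> e; have e1 : sash_of (st (take k y)) = sash_of (st (take k y')) := congr1 fst e.
have e2 : sash_of (st (drop k y)) = sash_of (st (drop k y')) := congr1 snd e.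
have uy := is_perm_uniq py.
have [k0 kC] := andP hk; have kC1 : k <= (slen C).+1 := leqW kC.
have w1 : take k y = take k y'.
  apply: st_inj; [exact: take_uniq | by apply: (perm_trans l1); rewrite perm_sym |].
  by apply: (pell_sash_of_inj p1 p1' _ _ e1); rewrite !size_st !size_takel ?sy ?sy'.
have w2 : drop k y = drop k y'.
  apply: st_inj; [exact: drop_uniq | by apply: (perm_trans l2); rewrite perm_sym |].
  by apply: (pell_sash_of_inj p2 p2' _ _ e2);
    rewrite !size_st !size_drop ?sy ?sy' ?subn_gt0.
by rewrite -(cat_take_drop k y) w1 w2 cat_take_drop.
Qed.

(** That a permutation cut along [t] has sash [C] means that [t] is admissible and the
sashes of the two parts lie in the two intervals of the dotting; conversely, all sashes in
these intervals are realized by [word_exists], and only once by [st_inj]. *)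
Lemma perm_parts : perm_eq (map parts cuts_t)
  (if allowable C (diff t) && (black_or_left C (dot_pos (diff t) 1) == bit t 1)
   then dotted_pairs C (diff t) else [::]).
Proof.
have tC : size t = (slen C).+1 by rewrite size_tuple.
apply: uniq_perm => [||[F G]].
- by rewrite map_inj_in_uniq ?filter_uniq ?cuts_uniq //; apply: parts_inj.
- by case: ifP => // _; apply: dotted_pairs_uniq.
have nt : count id (compl t) = size t - count id t.
  by rewrite count_map -(count_predC id t) addKn.
apply/mapP/idP => [[[y k] h]|].
  have [[py sy hs hk] bt p1 p2] := cuts_tP h; have [k1 k2] := size_cut h.
  have uy := is_perm_uniq py.
  have [i1 i2] := (pell_is_perm p1, pell_is_perm p2).
  have [k0 kC] := andP hk; have ky : k < size y by rewrite sy ltnS.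
  have yk : 0 < size y - k by rewrite subn_gt0.
  have s1 : size (st (take k y)) = k by rewrite size_st size_takel // ltnW.
  have s2 : size (st (drop k y)) = size y - k by rewrite size_st size_drop.
  move=> eFG; have eF : F = sash_of (st (take k y)) := congr1 fst eFG.
  have eG : G = sash_of (st (drop k y)) := congr1 snd eFG.
  have lF : lev F = levels (st (take k y)) by rewrite eF lev_sash_of ?s1.
  have lG : lev G = levels (st (drop k y)) by rewrite eG lev_sash_of ?s2.
  have tn : 0 < count id t < size t by rewrite -k1 tC k0 -sy.
  have eC : C = sash_of y by move: hs; rewrite sigmaE ?sy // => -[].
  have FS : F \in Sigma (count id t).-1 by rewrite mem_Sigma eF slen_sash_of ?s1 // k1.
  have GS : G \in Sigma (count id (compl t)).-1.
    by rewrite mem_Sigma eG slen_sash_of ?s2 // k2.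
  have [|fw _] := @merge_fits C t (lev F) (lev G) tC (lev_level_word F) (lev_level_word G).
    by move: GS; rewrite mem_Sigma size_lev => /eqP.
  have [|ad fA fB] := fw.
    move=> p hp0; have hp : 0 < p < size y by rewrite sy -tC.
    rewrite {1}eC lv_sash_of // lF lG -bt.
    by apply: plevel_merge => //; apply: ltnW.
  rewrite (introT (allowableP tC) (conj tn ad)) mem_dotted_pairs.
  apply/andP; split; first exact/(intervalA tC ad tn).
  exact/(intervalB tC ad tn).
case: (allowableP tC) => // -[tn ad].
rewrite mem_dotted_pairs =>
  /andP[/(intervalA tC ad tn)[FS fA] /(intervalB tC ad tn)[GS fB]].
have [[pF sF _] [pG sG _]] := (etaP F, etaP G).
rewrite !mem_Sigma in FS GS.
have [||y [py sy e1 e2 bt]] :=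
  @word_exists t (Defs.eta F) (Defs.eta G) (pell_is_perm pF) (pell_is_perm pG).
- by rewrite sF (eqP FS) prednK //; case/andP: tn.
- by rewrite sG (eqP GS) nt; lia.
set k := count id t in tn FS e1 e2 bt.
have hk : 0 < k <= slen C by rewrite tC in tn.
have eC : sash_of y = C.
  have [_ bw] := @merge_fits C t (lev F) (lev G) tC (lev_level_word F) (lev_level_word G)
     (etrans (size_lev G) (eqP GS)).
  apply: lev_inj; rewrite lev_sash_of ?sy // ?tC //.
  apply: (@eq_from_nth _ 0); first by rewrite size_map size_iota sy size_lev tC.
  move=> i; rewrite size_map size_iota => hi; rewrite nth_levels //.
  have hp : 0 < i.+1 < size t by move: hi; rewrite sy tC; lia.
  have := bw (And3 ad fA fB) i.+1 hp; rewrite /lv /= => ->.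
  rewrite (plevel_merge (k := k)) // ?e1 ?e2 ?sy //; last by rewrite tC; lia.
  by rewrite bt -!levels_eta.
exists (y, k); last by rewrite /parts [(_, _).1]/= [(_, _).2]/= e1 e2 !sash_of_eta.
rewrite mem_filter mem_cuts py sy tC e1 e2 pF pG hk sigmaE ?sy ?tC // eC !eqxx /= andbT.
by apply/eqP/val_inj; move: bt; rewrite tC.
Qed.
End Fibre.

Local Open Scope ring_scope.

(** * The coproduct *)

Section Linear.
Variable K : fieldType.

HB.instance Definition _ (T : choiceType) (M : lmodType K) (f : T -> M) :=
  GRing.isZmodMorphism.Build {freeg T / K} M (fglift f) (lift_is_additive f).

Lemma fgliftU (T : choiceType) (M : lmodType K) (f : T -> M) (x : T) :
  fglift f (<< x >> : {freeg T / K}) = f x.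
Proof. by rewrite liftU scale1r. Qed.

Lemma tensU (T U : choiceType) (a : T) (b : U) :
  tens (<< a >> : {freeg T / K}) (<< b >> : {freeg U / K}) = << (a, b) >>.
Proof. by rewrite /tens !fgliftU. Qed.

Lemma tens0l (T U : choiceType) (v : {freeg U / K}) : tens (0 : {freeg T / K}) v = 0.
Proof. by rewrite /tens raddf0. Qed.

Lemma tens_suml (T U : choiceType) I (r : seq I) (P : pred I) (u : I -> {freeg T / K})
    (v : {freeg U / K}) :
  tens (\sum_(i <- r | P i) u i) v = \sum_(i <- r | P i) tens (u i) v.
Proof. by rewrite /tens raddf_sum. Qed.

Lemma tens_sumU (T U : choiceType) I (r : seq I) (P : pred I) (a : T)
    (v : I -> {freeg U / K}) :
  tens << a >> (\sum_(i <- r | P i) v i) = \sum_(i <- r | P i) tens << a >> (v i).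
Proof. by rewrite /tens fgliftU raddf_sum; apply: eq_bigr => i _; rewrite fgliftU. Qed.

Lemma tens_rho a b : tens (rho K a) (rho K b) =
  if pell a && pell b then << (a, b) >> else 0.
Proof.
rewrite /rho; case: (pell a) => /=; last by rewrite tens0l.
by case: (pell b); rewrite ?tensU // /tens fgliftU raddf0.
Qed.

Lemma DeltaS_sum C : DeltaS K C =
  \sum_(y <- permutations (iota 1 (slen C).+1) | sigma y == Some C)
   \sum_(0 <= k < (slen C).+2 | pell (st (take k y)) && pell (st (drop k y)))
     << (sigma (st (take k y)), sigma (st (drop k y))) >>.
Proof.
have [pe se ee] := etaP C.
rewrite /DeltaS /csum /Delta /tens_map se !raddf_sum /=.
rewrite big_seq_cond [RHS]big_seq_cond.
apply: congr_big => // [y|y /andP[hy _]].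
  rewrite mem_permutations; case hy: (perm_eq _ _); rewrite ?andFb // !andTb.
  have sy : size y = (slen C).+1 by rewrite (perm_size hy) /= size_iota.
  by rewrite pi_downE ?ee // ?sy // /is_perm sy.
have sy : size y = (slen C).+1.
  by move: hy; rewrite mem_permutations => /perm_size ->; rewrite /= size_iota.
rewrite fgliftU !raddf_sum /= sy big_mkord [RHS]big_mkcond.
apply: eq_bigr => i _; rewrite tensU fgliftU /= tens_rho.
by case: ifP => _; rewrite ?raddf0 // fgliftU /= tensU.
Qed.

Lemma tens_interval D E D' E' :
  tens (interval_sum K D E) (interval_sum K D' E') =
  \sum_(p <- [seq (F, G) | F <- [seq F <- Sigma (slen D) | sash_le D F && sash_le F E],
                           G <- [seq G <- Sigma (slen D') | sash_le D' G && sash_le G E']])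
    << (Some p.1, Some p.2) >>.
Proof.
rewrite big_allpairs big_filter tens_suml; apply: eq_bigr => F _.
by rewrite tens_sumU big_filter; apply: eq_bigr => G _; rewrite tensU.
Qed.
End Linear.

Section Assembly.
Variable K : fieldType.

(** The only Pell permutation with sash [C] is [eta C]; it carries the two extreme cuts. *)
Lemma sum_pell_sigma C (X : seq nat -> {freeg (esash * esash) / K}) :
  \sum_(y <- permutations (iota 1 (slen C).+1) | (sigma y == Some C) && pell y) X y
  = X (Defs.eta C).
Proof.
have [pe se ee] := etaP C.
rewrite big_seq_cond (eq_bigl (fun y =>
  (y \in permutations (iota 1 (slen C).+1)) && (y == Defs.eta C))).
  rewrite -big_seq_cond -big_filter (_ : [seq y <- _ | _] = [:: Defs.eta C]) ?big_seq1 //.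
  rewrite -(@filter_pred1_uniq _ (permutations (iota 1 (slen C).+1)) (Defs.eta C)) //.
    exact: permutations_uniq.
  by rewrite mem_permutations -se; apply: pell_is_perm.
move=> y; case hy: (y \in _) => //=; apply/andP/eqP => [[/eqP sy py]|->];
  last by rewrite ee pe.
have ss : size y = (slen C).+1.
  by move: hy; rewrite mem_permutations => /perm_size ->; rewrite /= size_iota.
rewrite -[y]eta_sash_of ?ss //; congr Defs.eta.
by move: sy; rewrite sigmaE ?ss // => -[].
Qed.

(** Cutting before the first or after the last letter leaves the whole permutation on one
side, and only a Pell permutation survives there. *)
Lemma DeltaS_ends C : DeltaS K C =
  << (None, Some C) >> + << (Some C, None) >> +
  \sum_(yk <- cuts C) << (Some (parts yk).1, Some (parts yk).2) >>.
Proof.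
rewrite DeltaS_sum.
have ends y : y \in permutations (iota 1 (slen C).+1) ->
    \sum_(0 <= k < (slen C).+2 | pell (st (take k y)) && pell (st (drop k y)))
      (<< (sigma (st (take k y)), sigma (st (drop k y))) >> : {freeg (esash * esash) / K}) =
    (if pell y then << (None, sigma y) >> else 0) +
    (if pell y then << (sigma y, None) >> else 0) +
    \sum_(k <- iota 1 (slen C) | pell (st (take k y)) && pell (st (drop k y)))
      << (Some (parts (y, k)).1, Some (parts (y, k)).2) >>.
  rewrite mem_permutations => hy; have sy : size y = (slen C).+1.
    by rewrite (perm_size hy) size_iota.
  have py : is_perm y by rewrite /is_perm sy.
  have e0 : pell (st (take 0 y)) && pell (st (drop 0 y)) = pell y.
    by rewrite take0 drop0 (st_id py).
  have en : pell (st (take (slen C).+1 y)) && pell (st (drop (slen C).+1 y)) = pell y.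
    by rewrite -sy take_size drop_size (st_id py) andbT.
  have s0 : (sigma (st (take 0 y)), sigma (st (drop 0 y))) = (None, sigma y).
    by rewrite take0 drop0 (st_id py).
  have sn : (sigma (st (take (slen C).+1 y)), sigma (st (drop (slen C).+1 y))) =
    (sigma y, None).
    by rewrite -sy take_size drop_size (st_id py).
  have -> : index_iota 0 (slen C).+2 = 0 :: rcons (iota 1 (slen C)) (slen C).+1.
    rewrite /index_iota subn0 -cats1 -[in LHS](addn1 (slen C).+1) iotaD /=.
    by rewrite add0n.
  rewrite big_cons big_rcons e0 en s0 sn.
  have mid : \sum_(k <- iota 1 (slen C) | pell (st (take k y)) && pell (st (drop k y)))
      (<< (sigma (st (take k y)), sigma (st (drop k y))) >> : {freeg (esash * esash) / K}) =
     \sum_(k <- iota 1 (slen C) | pell (st (take k y)) && pell (st (drop k y)))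
      << (Some (parts (y, k)).1, Some (parts (y, k)).2) >>.
    rewrite big_seq_cond [RHS]big_seq_cond; apply: eq_bigr => k /andP[+ _].
    rewrite mem_iota add1n ltnS => /andP[k0 kC].
    rewrite !sigmaE //.
      by rewrite size_st size_drop sy subn_gt0.
    by rewrite size_st size_takel // sy ltnW.
  rewrite mid /=; case: (pell y); last by rewrite !(addr0, add0r).
  by rewrite -addrA; congr (_ + _); apply: addrC.
rewrite big_seq_cond (eq_bigr _ (fun y h => ends y (proj1 (andP h)))) -big_seq_cond.
rewrite !big_split /= -!big_mkcondr !sum_pell_sigma.
have [pe se ee] := etaP C; rewrite ee; congr (_ + _).
rewrite /cuts big_allpairs_dep big_filter; apply: eq_bigr => y _.
by rewrite big_filter.
Qed.

Lemma sum_fibre C (t : (slen C).+1.-tuple bool) :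
  \sum_(yk <- cuts C | letter_bits (slen C).+1 (take yk.2 yk.1) == t)
     (<< (Some (parts yk).1, Some (parts yk).2) >> : {freeg (esash * esash) / K}) =
  if allowable C (diff t) && (black_or_left C (dot_pos (diff t) 1) == bit t 1)
  then \sum_(p <- dotted_pairs C (diff t)) << (Some p.1, Some p.2) >> else 0.
Proof.
rewrite -big_filter -(big_map parts predT (fun p => << (Some p.1, Some p.2) >>)).
rewrite (perm_big _ (perm_parts t)) /=; case: ifP => // _.
by rewrite big_nil.
Qed.

Lemma size_diff_tuple m (t : m.+1.-tuple bool) : size (diff t) == m.
Proof. by rewrite size_diff size_tuple. Qed.

Lemma size_integ_tuple m e (d : m.-tuple bool) : size (integ e d) == m.+1.
Proof. by rewrite size_mkseq size_tuple. Qed.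

End Assembly.

Theorem theorem3p10 (K : fieldType) (n : nat) (C : sash)
    (n_gt0 : (0 < n)%N) (CSigma : C \in Sigma n.-1) :
  DeltaS K C =
    tens << None >> << Some C >> + tens << Some C >> << None >>
    + \sum_(d : n.-1.-tuple bool | allowable C d)
        tens (interval_sum K (lowA C d) (highA C d))
             (interval_sum K (lowB C d) (highB C d)).
Proof.
case: n n_gt0 CSigma => // n _; rewrite mem_Sigma [n.+1.-1]/= => /eqP <-.
rewrite DeltaS_ends !tensU; congr (_ + _).
rewrite (partition_big (fun yk => letter_bits (slen C).+1 (take yk.2 yk.1)) xpredT) //=.
under eq_bigr => t _ do rewrite sum_fibre.
rewrite -big_mkcond /=.
(* Dottings correspond to sets of letters; the type of the first dot decides which side
   of the dots is the set. *)
pose h (t : (slen C).+1.-tuple bool) := Tuple (size_diff_tuple t).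
pose h' (d : (slen C).-tuple bool) :=
  Tuple (size_integ_tuple (black_or_left C (dot_pos d 1)) d).
rewrite [RHS](reindex_onto h h'); last by move=> d _; apply/val_inj/diff_integ.
apply: eq_big => [t|t _]; last by rewrite tens_interval.
congr (_ && _); apply/eqP/eqP => [e|/(congr1 val) /= e].
  by apply/val_inj; rewrite /= e integ_diff // size_tuple.
by rewrite -{2}e bit_integ // /cnt take0; case: (black_or_left _ _).
Qed.
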